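(* Assume that there exists a strictly increasing sequence of real numbers $\{\alpha_j\}_{j=0}^n$ such that, for every $j\in\{0,\dots,n\}$ and every $x\in C^1_T$, $$(-1)^j\int_0^T \left[h(x(t))x^{\Delta}(t)+g(x(t))\right]\Delta t<0\quad\text{whenever } x(0)=\alpha_j \text{ and } \|x^{\Delta}\|_\infty<a.$$ Then, for any continuous $T$-periodic function $p:\mathbb{T}\to\mathbb{R}$ with mean value zero, i.e. $\frac1T\int_0^T p(t)\,\Delta t=0$, the equation $$(\varphi(x^{\Delta}(t)))^{\Delta}+h(x(t))x^{\Delta}(t)+g(x(t-r))=p(t),\qquad t\in\mathbb{T},$$ has at least $n$ different $T$-periodic solutions.
   Context: Setting: $T>0$ and $r\ge 0$ are real numbers. $\mathbb{T}\subset\mathbb{R}$ is a time scale (a nonempty closed subset of $\mathbb{R}$) that is $T$-periodic, i.e. $\mathbb{T}+T=\mathbb{T}$, with $\mathbb{T}-r\subset\mathbb{T}$ and $0\in\mathbb{T}$. $x^\Delta$ denotes the usual (Hilger) delta derivative on $\mathbb{T}$ and $\int\cdot\,\Delta t$ the usual delta integral on $\mathbb{T}$. $\varphi:(-a,a)\to\mathbb{R}$ is an increasing homeomorphism with $0<a<+\infty$ and $\varphi(0)=0$; $h,g:\mathbb{R}\to\mathbb{R}$ are continuous functions. $C^1_T$ is the Banach space of all continuous $T$-periodic functions $x:\mathbb{T}\to\mathbb{R}$ that are $\Delta$-differentiable with continuous $\Delta$-derivative. $\|y\|_\infty=\sup_{t\in\mathbb{T}}|y(t)|$. A $T$-periodic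 solution of the equation is a function $x\in C^1_T$ with $|x^\Delta(t)|<a$ for all $t\in\mathbb{T}$ (so that $\varphi(x^\Delta)$ is defined), such that $\varphi(x^\Delta)$ is of class $C^1$ (i.e. $\Delta$-differentiable with continuous $\Delta$-derivative), and satisfying the equation for all $t\in\mathbb{T}$. Solutions are different if they are different as functions on $\mathbb{T}$. *)

(* Defs.v *)
From HB Require Import structures.
From mathcomp Require Import all_boot all_order all_algebra.
From mathcomp Require Import all_classical all_reals all_analysis.

Set Implicit Arguments.
Unset Strict Implicit.
Unset Printing Implicit Defensive.
Import Order.TTheory GRing.Theory Num.Theory.
Import numFieldNormedType.Exports.
Local Open Scope classical_set_scope.
Local Open Scope ring_scope.

(* A function on a time scale TS is represented by a total function R -> R,   *)
(* of which only the values on TS are ever used.                              *)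

Section TimeScale.
Variable R : realType.
Implicit Types (TS : set R) (f x y : R -> R) (t d T r : R).

Definition time_scale TS : Prop := TS !=set0 /\ closed TS.

Definition periodic_time_scale TS T : Prop := [set t + T | t in TS] = TS.

(* The library has inf set0 = 0, whereas the usual convention is that the     *)
(* forward jump of max TS is max TS. The two never differ on a T-periodic     *)
(* time scale with T > 0, which has no maximum (for the same reason, TS^kappa *)
(* is TS in the definitions below).                                           *)
Definition forward_jump TS t : R := inf [set s | TS s /\ t < s].

Definition is_delta_derivative TS f t d : Prop :=
  forall e : R, 0 < e -> \forall s \near within TS (nbhs t),
    `|f (forward_jump TS t) - f s - d * (forward_jump TS t - s)|
      <= e * `|forward_jump TS t - s|.

Definition delta_derivable TS f t : Prop :=
  exists d, is_delta_derivative TS f t d.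

Definition delta_derivative TS f t : R := xget 0 (is_delta_derivative TS f t).

Definition delta_antiderivative TS F f : Prop :=
  forall t, TS t -> is_delta_derivative TS F t (f t).

(* Cauchy delta integral: F b - F a for any delta antiderivative F of f       *)
(* (with value 0 if f has none; continuous functions always have one).        *)
Definition delta_integral TS f (a b : R) : R :=
  xget 0 [set v | exists2 F, delta_antiderivative TS F f & v = F b - F a].

Definition periodic_on TS T f : Prop := forall t, TS t -> f (t + T) = f t.

Definition delta_C1 TS f : Prop :=
  [/\ {within TS, continuous f},
      forall t, TS t -> delta_derivable TS f t &
      {within TS, continuous (delta_derivative TS f)}].

Definition C1T TS T x : Prop := periodic_on TS T x /\ delta_C1 TS x.

Definition sup_norm TS y : \bar R := ereal_sup [set (`|y t|)%:E | t in TS].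

Definition homeomorphism (A B : set R) f : Prop :=
  exists g : R -> R,
    [/\ set_fun A B f /\ set_fun B A g,
        {in A, cancel f g}, {in B, cancel g f},
        {within A, continuous f} & {within B, continuous g}].

Definition increasing_homeomorphism (A B : set R) f : Prop :=
  homeomorphism A B f /\
  (forall u v, A u -> A v -> u < v -> f u < f v).

Definition periodic_solution TS T r (a : R) (phi h g p : R -> R) x : Prop :=
  [/\ C1T TS T x,
      forall t, TS t -> `|delta_derivative TS x t| < a,
      delta_C1 TS (fun t => phi (delta_derivative TS x t)) &
      forall t, TS t ->
        delta_derivative TS (fun s => phi (delta_derivative TS x s)) t
          + h (x t) * delta_derivative TS x t + g (x (t - r)) = p t].

End TimeScale.

(* Main.v *)
Require Import Defs.
From HB Require Import structures.
From mathcomp Require Import all_boot all_order all_algebra.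
From mathcomp Require Import all_classical all_reals all_analysis.
From mathcomp Require Import measurable_realfun.
From mathcomp Require Import ring lra.
Set Implicit Arguments.
Unset Strict Implicit.
Unset Printing Implicit Defensive.
Import Order.TTheory GRing.Theory Num.Theory.
Import numFieldNormedType.Exports.
Local Open Scope classical_set_scope.
Local Open Scope ring_scope.

(** Why the theorem holds. Let psi be the inverse of phi. For each pair of
    consecutive levels lo = alpha_j < hi = alpha_(j+1) a solution x with
    lo < x(0) < hi is constructed; the n solutions then differ at t = 0.

    The unknowns are a number c, standing for x(0), and a T-periodic function v,
    standing for the momentum phi(x^Delta). From them one forms the velocity
    u = psi(v), the trajectory x = c + P u and the forcing
    N = p - h(x) u - g(x(. - r)), where P f is the primitive of f minus its mean,
    which is again T-periodic. The equations to solve are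
      v = P N + clip(v(0) - int u)       and    c = clip(c + (-1)^j int N),
    with integrals over one period, the first clip to [-S, S] and the second to
    [lo, hi]. Because phi is singular, |u| < a whatever v is; so x and N are
    bounded a priori, P N is Lipschitz, and Schauder's theorem applies
    (schauder_lipschitz). At a fixed point the two truncations are inactive.
    If int u <> 0, then v(0) = S or v(0) = - S, and |P N| <= S gives v, hence u,
    a constant sign which contradicts the direction of the truncation; so
    int u = 0 and x^Delta = u. As p has mean zero and integration over a period
    does not see the delay, int N = - int (h(x) x^Delta + g(x)), so the sign
    hypothesis pushes c strictly inwards at lo and at hi; hence lo < c < hi and
    int N = 0, and v^Delta = N is the equation (shooting_solution).

    Schauder's theorem is needed only for Lipschitz functions on a totally
    bounded space. On a finite net it is an approximate Brouwer theorem, whose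
    solutions are spread over the space by McShane's extension and have a cluster
    point by Tychonoff's theorem. Approximate Brouwer follows from Kuhn's lemma
    on labellings of a cubical grid (kuhn_cube), which is Stokes' theorem for a
    product of coboundaries modulo 2 (sum_cup_coboundary).

    On the time scale, everything rests on the mean value inequality
    (delta_mean_value), which gives uniqueness and all estimates of primitives;
    their existence comes from the Lebesgue integral of f(floor_ts t), as the gap
    from t to sigma(t) then contributes (sigma(t) - t) f(t). The invariance of
    the integral under the delay needs TS - r = TS, which follows from
    TS - r <= TS because translation by r almost returns modulo T
    (simultaneous_return). *)

(** * Kuhn's lemma on cubical grids *)

Lemma addxx_F2 (x : 'F_2) : x + x = 0.
Proof. exact/addrr_pchar2/(@pchar_Fp 2). Qed.

Section CubicalCochains.
Variables (I : finType) (X : Type) (s : I -> X -> X).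
Hypothesis sC : forall i j x, s i (s j x) = s j (s i x).

(** The cup product of the coboundaries of the 0-cochains in L, modulo 2, on the
    cube with lowest corner q and set of directions D. The sum runs over the
    monotone edge paths that start at q, and the k-th edge of a path carries the
    coboundary of the k-th cochain. *)
Fixpoint cup_coboundary (L : seq (X -> 'F_2)) (D : {set I}) (q : X) : 'F_2 :=
  if L is l :: L' then
    \sum_(i in D) (l (s i q) + l q) * cup_coboundary L' (D :\ i) (s i q)
  else 1.

Lemma sum_sym_F2 (D : {set I}) (F : I -> I -> 'F_2) :
  (forall i j, F i j = F j i) ->
  \sum_(i in D) \sum_(j in D :\ i) F i j = 0.
Proof.
move=> Fsym; pose lt (i j : I) := (enum_rank i < enum_rank j)%N.
have split i : \sum_(j in D :\ i) F i j =
    \sum_(j in D | lt i j) F i j + \sum_(j in D | lt j i) F i j.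
  rewrite (bigID (lt i)) /=; congr (_ + _); apply: eq_bigl => j;
    rewrite !inE /lt -?leqNgt.
    case: eqVneq => [->|]; by rewrite ?ltnn ?andbF //= ?andbT.
  case: eqVneq => [->|ji]; rewrite ?ltnn ?andbF //=.
  rewrite [(_ <= _)%N]leq_eqVlt; case: eqP => // /val_inj/enum_rank_inj e.
  by rewrite e eqxx in ji.
rewrite (eq_bigr _ (fun i _ => split i)) big_split /=.
rewrite [X in _ + X](exchange_big_dep (mem D)) /=; last by move=> i j _ /andP[].
rewrite -big_split /= big1// => i iD.
rewrite [X in _ + X](eq_bigr (F i)); last by move=> j _; exact: Fsym.
rewrite [X in _ + X](eq_bigl (fun j => (j \in D) && lt i j)) ?addxx_F2//.
by move=> j; rewrite iD.
Qed.

(** The term l q of each factor l (s i q) + l q multiplies the part of the closed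
    sum at the far faces, which can therefore be traded for the near faces. *)
Lemma cup_coboundary_stokes_of L :
  (forall (D : {set I}) q, \sum_(i in D) (cup_coboundary L (D :\ i) (s i q)
                 + cup_coboundary L (D :\ i) q) = 0) ->
  forall l (D : {set I}) q, cup_coboundary (l :: L) D q =
  \sum_(i in D) (l (s i q) * cup_coboundary L (D :\ i) (s i q)
                 + l q * cup_coboundary L (D :\ i) q).
Proof.
move=> closed l D q /=.
have := congr1 ( *%R (l q)) (closed D q); rewrite /= mulr0 mulr_sumr => c0.
rewrite -[LHS]addr0 -[X in _ + X]c0 -big_split; apply: eq_bigr => i _ /=.
by rewrite mulrDl mulrDr addrA -(addrA (l _ * _)) addxx_F2 addr0.
Qed.

(** A product of coboundaries is closed. In the inductive step the boundary of the
    boundary is a sum over ordered pairs of directions whose terms are symmetric,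
    so they cancel in pairs. *)
Lemma cup_coboundary_closed L (D : {set I}) q :
  \sum_(i in D) (cup_coboundary L (D :\ i) (s i q)
                 + cup_coboundary L (D :\ i) q) = 0.
Proof.
elim: L D q => [|l L IH] D q; first by rewrite big1// => i _; exact: addxx_F2.
pose B (x : X) (i j : I) := l x * cup_coboundary L (D :\ i :\ j) x.
have Bsym x i j : B x i j = B x j i by rewrite /B finset.setDDl finset.setUC -finset.setDDl.
rewrite (eq_bigr (fun i => \sum_(j in D :\ i)
   ((B (s j (s i q)) i j + B (s i q) i j) + (B (s j q) i j + B q i j)))).
  by apply: sum_sym_F2 => i j; rewrite sC !(Bsym _ j i) addrACA.
by move=> i _; rewrite !cup_coboundary_stokes_of // -big_split.
Qed.

Lemma cup_coboundary_stokes l L (D : {set I}) q :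
  cup_coboundary (l :: L) D q =
  \sum_(i in D) (l (s i q) * cup_coboundary L (D :\ i) (s i q)
                 + l q * cup_coboundary L (D :\ i) q).
Proof. exact/cup_coboundary_stokes_of/cup_coboundary_closed. Qed.

(** A nonzero term of the sum is an edge path along which each labelling of the
    list changes in its turn. The predicate C is any property that is inherited by
    the successive corners of such a path; it serves to say where they are. *)
Lemma cup_coboundary_neq0 (T : eqType) (lam : T -> X -> 'F_2) (e : seq T)
    (D : {set I}) (q : X) (C : {set I} -> X -> Prop) :
  C D q -> (forall D' x i, C D' x -> i \in D' -> C (D' :\ i) (s i x)) ->
  cup_coboundary (map lam e) D q != 0 ->
  forall i, i \in e -> exists x y D1 D2, [/\ C D1 x, C D2 y & lam i x != lam i y].
Proof.
move=> CDq Cs; elim: e D q CDq => [//|j e IH] D q CDq /=.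
case: (pickP (fun i => (i \in D) &&
  ((lam j (s i q) + lam j q) * cup_coboundary (map lam e) (D :\ i) (s i q) != 0))).
  move=> i /andP[iD]; rewrite mulf_eq0 negb_or => /andP[lj ce] _ k.
  rewrite inE => /predU1P[->|ke]; last first.
    by apply: IH ke; [exact: Cs CDq iD|].
  exists (s i q), q, (D :\ i), D; split => //; first exact: Cs.
  by apply: contra lj => /eqP ->; rewrite addxx_F2.
move=> none; rewrite big1 ?eqxx// => i iD.
by have /= := none i; rewrite iD /= => /negbFE/eqP.
Qed.

End CubicalCochains.

Section KuhnCube.
Variables (n N : nat).
Let X := {ffun 'I_n -> 'I_N.+1}.
Variable lam : 'I_n -> X -> 'F_2.
Hypothesis lam0 : forall i (x : X), x i = ord0 -> lam i x = 0.
Hypothesis lamN : forall i (x : X), x i = ord_max -> lam i x = 1.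

(** The successor is cyclic so that the shift is injective and sums can be
    reindexed along it. A cube with a corner whose coordinates are all below N
    does not wrap around. *)
Definition shift (i : 'I_n) (x : {ffun 'I_n -> 'I_N.+1}) :=
  [ffun j => if j == i then ordS (x j) else x j].

Let shiftC i j x : shift i (shift j x) = shift j (shift i x).
Proof. by apply/ffunP => k; rewrite !ffunE; case: eqP => // _; case: eqP. Qed.

Let shift_inj i : injective (shift i).
Proof.
move=> x y /ffunP e; apply/ffunP => j; have := e j; rewrite !ffunE.
by case: eqP => // _ /ordS_inj.
Qed.

Let C := cup_coboundary shift.

(** On a face x j = 0 or x j = N the labelling lam j is constant, so its
    coboundary vanishes there. *)
Lemma cup_coboundary_face (e : seq 'I_n) (D : {set 'I_n}) (x : X) j :
  j \in e -> j \notin D -> x j = ord0 \/ x j = ord_max ->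
  C (map lam e) D x = 0.
Proof.
elim: e D x => [//|i e IH] D x; rewrite inE => je jD xj /=.
rewrite /C /= big1// => k kD.
have sj : shift k x j = x j by rewrite ffunE; case: eqP jD => // ->; rewrite kD.
case: (eqVneq j i) je => [<- _|ji /= je].
  have -> : lam j (shift k x) = lam j x.
    by case: xj => xj; [rewrite !lam0|rewrite !lamN]; rewrite ?sj.
  by rewrite addxx_F2 mul0r.
by rewrite [X in _ * X]IH ?mulr0 ?sj// inE negb_and negbK jD orbT.
Qed.

(** The lowest corners of the unit cubes of the face on which every coordinate
    outside D equals N. *)
Let face (D : {set 'I_n}) : pred X := fun q => [forall i, (q i < N)%N == (i \in D)].
(** As for the previous set, with coordinate i left free. *)
Let line (D : {set 'I_n}) i : pred X :=
  fun q => [forall j, (j != i) ==> ((q j < N)%N == (j \in D))].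

Let ltN (k : 'I_N.+1) : (k < N)%N = (k != ord_max).
Proof. by rewrite -val_eqE /= ltn_neqAle -ltnS ltn_ord andbT. Qed.

Let faceE (D : {set 'I_n}) i (q : X) : i \in D -> face D q = line D i q && (q i != ord_max).
Proof.
move=> iD; apply/forallP/andP => [Gq|[/forallP Hq qi] j].
  split; first by apply/forallP => j; apply/implyP.
  by rewrite -ltN; have /eqP -> := Gq i.
case: (eqVneq j i) => [->|ji]; first by rewrite iD ltN qi.
exact: (implyP (Hq j)).
Qed.

Let faceD1E (D : {set 'I_n}) i (q : X) : face (D :\ i) q = line D i q && (q i == ord_max).
Proof.
apply/forallP/andP => [Gq|[/forallP Hq qi] j].
  split; last by have /eqP := Gq i; rewrite ltN !inE eqxx /= => /negbFE.
  apply/forallP => j; apply/implyP => ji.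
  by have /eqP -> := Gq j; rewrite !inE ji.
rewrite !inE; case: (eqVneq j i) => [->|ji]; first by rewrite ltN qi.
exact: (implyP (Hq j)).
Qed.

(** Modulo 2 a sum over the two ends of all edges in direction i reduces to the
    two extreme faces, as inner points occur twice. *)
Let telescope (D : {set 'I_n}) i (B : X -> 'F_2) : i \in D ->
  \sum_(q | face D q) (B (shift i q) + B q) =
  \sum_(q | line D i q && (q i == ord_max)) B q +
  \sum_(q | line D i q && (q i == ord0)) B q.
Proof.
move=> iD; rewrite big_split /=.
have -> : \sum_(q | face D q) B (shift i q) = \sum_(q | line D i q && (q i != ord0)) B q.
  rewrite [RHS](reindex_inj (@shift_inj i)); apply: eq_bigl => q.
  rewrite (faceE _ iD) /line; congr (_ && _).
    apply: eq_forallb => j; case: (eqVneq j i) => //= ji.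
    by rewrite ffunE (negbTE ji).
  rewrite ffunE eqxx -!val_eqE /=; have [->|qN] := eqVneq (q i : nat) N.
    by rewrite modnn.
  by rewrite modn_small// ltnS ltn_neqAle qN -ltnS ltn_ord.
rewrite (eq_bigl _ _ (fun q => faceE q iD)).
have E (P : pred X) : \sum_(q | line D i q && ~~ P q) B q =
    \sum_(q | line D i q) B q + \sum_(q | line D i q && P q) B q.
  by rewrite [X in _ = X + _](bigID P)/= addrAC addxx_F2 add0r.
rewrite (E (fun q => q i == ord0)) (E (fun q => q i == ord_max)).
by rewrite addrACA addxx_F2 add0r addrC.
Qed.

(** By Stokes the sum over the face with free directions i :: e reduces to its
    boundary. There only the side x i = N survives: lam i is 0 on the opposite
    side, and the sides of the other directions are null by
    cup_coboundary_face. On x i = N, lam i is 1, and what is left is the same sum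
    with one direction less. *)
Lemma sum_cup_coboundary (e : seq 'I_n) : uniq e ->
  \sum_(q | face [set i in e] q) C (map lam e) [set i in e] q = 1.
Proof.
elim: e => [_|i e IH /= /andP[ie ue]].
  rewrite (big_pred1 [ffun _ => ord_max]) // => q /=.
  apply/forallP/eqP => [Gq|-> j]; last by rewrite ffunE !inE ltN eqxx.
  by apply/ffunP => j; have /eqP := Gq j; rewrite !inE ffunE ltN => /negbFE/eqP.
set D := [set j in i :: e].
have Di : D :\ i = [set j in e].
  apply/setP => j; rewrite !inE; case: eqVneq => [->|] //=.
  by rewrite (negbTE ie).
rewrite (eq_bigr _ (fun q _ => cup_coboundary_stokes shiftC _ _ D q)).
rewrite exchange_big /= (bigD1 i)/=; last by rewrite !inE eqxx.
rewrite [X in _ + X]big1 ?addr0.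
  rewrite (telescope (fun q => lam i q * C (map lam e) (D :\ i) q)); last first.
    by rewrite !inE eqxx.
  rewrite [X in _ + X]big1 ?addr0; last by move=> q /andP[_ /eqP q0]; rewrite lam0 ?mul0r.
  rewrite -(eq_bigl _ _ (fun q => faceD1E D i q)) Di -[RHS](IH ue).
  apply: eq_bigr => q; rewrite -Di faceD1E => /andP[_ /eqP qN].
  by rewrite lamN ?mul1r.
move=> j /andP[jD ji].
rewrite (telescope (fun q => lam i q * C (map lam e) (D :\ j) q))//.
have je : j \in e by move: jD; rewrite !inE (negbTE ji).
rewrite !big1 ?addr0// => q /andP[_ /eqP qj];
  rewrite (@cup_coboundary_face _ _ _ j) ?mulr0//; try (by [left|right]);
  by rewrite !inE eqxx.
Qed.

(** The sum of sum_cup_coboundary being 1, some unit cube carries a nonzero term, that is an edge path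
    which witnesses a change of every label. *)
Theorem kuhn_cube : exists q : X, (forall i, (q i < N)%N) /\
  forall i, exists x y : X, [/\ lam i x != lam i y,
    forall j, (q j <= x j <= (q j).+1)%N & forall j, (q j <= y j <= (q j).+1)%N].
Proof.
pose e := enum 'I_n; pose D := [set i in e].
have [q /andP[Gq Cq]|none] := pickP (fun q => face D q && (C (map lam e) D q != 0)); last first.
  have := sum_cup_coboundary (enum_uniq 'I_n).
  rewrite big1 => [/eqP|q Gq]; first by rewrite eq_sym oner_eq0.
  by have := none q; rewrite Gq /= => /negbFE/eqP.
have qN i : (q i < N)%N by have /forallP/(_ i)/eqP -> := Gq; rewrite inE mem_enum.
exists q; split => // i.
(* The corners of the cube at q which are met once the directions outside D'
   have been used. *)
pose near (D' : {set 'I_n}) (x : X) :=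
  forall j, (x j : nat) = (q j + (j \notin D'))%N.
have nearP D' x : near D' x -> forall j, (q j <= x j <= (q j).+1)%N.
  by move=> nx j; have xj := nx j; rewrite xj leq_addr -[(q j).+1]addn1 leq_add2l leq_b1.
have [|||x [y [D1 [D2 [/nearP nx /nearP ny lxy]]]]] :=
    @cup_coboundary_neq0 _ _ shift _ lam e D q near _ _ Cq i.
- by move=> j; rewrite inE mem_enum addn0.
- move=> D' x j nx jD' k; rewrite ffunE !inE; case: (eqVneq k j) => [->|kj] //=.
  by have xj := nx j; rewrite xj jD' addn0 addn1 modn_small// ltnS.
- by rewrite mem_enum.
by exists x, y.
Qed.

End KuhnCube.

(** * Approximate fixed points and cluster points in cubes *)

(** Label a grid point in coordinate i by whether f decreases that coordinate. In
    a cube of small mesh where every label takes both values, every coordinate of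
    f y - y nearly vanishes. *)
Lemma approx_brouwer (R : realType) (n : nat) (M : R)
    (f : ('I_n -> R) -> 'I_n -> R) : 0 < M ->
  (forall y, (forall i, `|y i| <= M) -> forall i, `|f y i| <= M) ->
  (forall e : R, 0 < e -> exists2 d : R, 0 < d &
    forall y y', (forall i, `|y i| <= M) -> (forall i, `|y' i| <= M) ->
    (forall i, `|y i - y' i| <= d) -> forall i, `|f y i - f y' i| <= e) ->
  forall e : R, 0 < e ->
  exists2 y, (forall i, `|y i| <= M) & forall i, `|f y i - y i| <= e.
Proof.
move=> M0 fM fc e e0.
have e20 : 0 < e / 2 by lra.
have [d d0 fd] := fc _ e20.
pose m := Num.min d (e / 2).
have m0 : 0 < m by rewrite lt_min d0.
pose N := (Num.trunc (2 * M / m)).+1.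
have Nm : 2 * M / m < N%:R := truncnS_gt _.
have N0 : 0 < N%:R :> R by rewrite ltr0n.
pose w := 2 * M / N%:R.
have w0 : 0 < w by rewrite divr_gt0// mulr_gt0.
have wm : w <= m.
  by rewrite /w ler_pdivrMr// (mulrC m) -ler_pdivrMr// ltW.
have [wd we] : w <= d /\ w <= e / 2.
  by move: wm; rewrite /m le_min => /andP[].
have wN : w * N%:R = 2 * M by rewrite /w divfK// gt_eqF.
pose pt (x : {ffun 'I_n -> 'I_N.+1}) (i : 'I_n) : R := - M + w * (x i)%:R.
have ptM (x : {ffun 'I_n -> 'I_N.+1}) i : `|pt x i| <= M.
  have : 0 <= w * (x i)%:R by rewrite mulr_ge0// ltW.
  have : w * (x i)%:R <= w * N%:R.
    by rewrite ler_pM2l// ler_nat -ltnS ltn_ord.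
  rewrite wN /pt => h1 h2; rewrite ler_norml; apply/andP; split; lra.
(* The second condition makes the label 0 on the face x i = 0 even when f fixes
   that coordinate. *)
pose lam (i : 'I_n) (x : {ffun 'I_n -> 'I_N.+1}) : 'F_2 :=
  if (f (pt x) i <= pt x i) && (x i != ord0) then 1 else 0.
have lam0 i (x : {ffun 'I_n -> 'I_N.+1}) : x i = ord0 -> lam i x = 0.
  by move=> xi; rewrite /lam xi eqxx andbF.
have lamN i (x : {ffun 'I_n -> 'I_N.+1}) : x i = ord_max -> lam i x = 1.
  move=> xi; rewrite /lam xi /= andbT.
  have -> : pt x i = M by rewrite /pt xi /= wN; lra.
  by rewrite (le_trans (ler_norm _))// fM.
have [q [_ qP]] := @kuhn_cube n N _ lam0 lamN.
have near (x : {ffun 'I_n -> 'I_N.+1}) j : (q j <= x j <= (q j).+1)%N -> pt q j <= pt x j <= pt q j + w.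
  move=> /andP[qx xq]; rewrite /pt.
  have : w * (q j)%:R <= w * (x j)%:R by rewrite ler_pM2l// ler_nat.
  have : w * (x j)%:R <= w * (q j).+1%:R by rewrite ler_pM2l// ler_nat.
  by rewrite -natr1 mulrDr mulr1 => h1 h2; apply/andP; split; lra.
have fnear (x : {ffun 'I_n -> 'I_N.+1}) i : (forall j, (q j <= x j <= (q j).+1)%N) ->
    `|f (pt q) i - f (pt x) i| <= e / 2.
  move=> xq; apply: fd => // j.
  by have /andP[h1 h2] := near _ _ (xq j); rewrite ler_norml; apply/andP; split; lra.
exists (pt q) => // i.
have lam1 (x : {ffun 'I_n -> 'I_N.+1}) : (forall j, (q j <= x j <= (q j).+1)%N) -> lam i x = 1 ->
    f (pt q) i - pt q i <= e.
  move=> xq; rewrite /lam; case: ifP => [/andP[fx _] _|_ /eqP]; last first.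
    by rewrite eq_sym oner_eq0.
  have := fnear _ i xq; rewrite ler_norml => /andP[h1 h2].
  by have /andP[h3 h4] := near _ _ (xq i); lra.
have lam2 (x : {ffun 'I_n -> 'I_N.+1}) : (forall j, (q j <= x j <= (q j).+1)%N) -> lam i x != 1 ->
    - e <= f (pt q) i - pt q i.
  move=> xq; rewrite /lam; case: ifP => [_|/negbT + _]; first by rewrite eqxx.
  rewrite negb_and negbK -ltNge => h.
  have h0 : pt x i <= f (pt x) i.
    case/orP: h => [/ltW//|/eqP xi].
    have -> : pt x i = - M by rewrite /pt xi /= mulr0 addr0.
    by have := fM _ (ptM x) i; rewrite ler_norml => /andP[].
  have := fnear _ i xq; rewrite ler_norml => /andP[h1 h2].
  by have /andP[h3 h4] := near _ _ (xq i); lra.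
have [x [y [lxy xq yq]]] := qP i; rewrite ler_norml; apply/andP.
have lamE (x' : {ffun 'I_n -> 'I_N.+1}) : (lam i x' == 1) || (lam i x' == 0).
  by rewrite /lam; case: ifP; rewrite eqxx ?orbT.
have [lx|lx] := eqVneq (lam i x) 1.
  split; [apply: (lam2 y)|exact: lam1 lx] => //.
  by rewrite eq_sym -lx.
split; first exact: lam2 lx.
apply: (lam1 y) => //; case/orP: (lamE y) => /eqP// ly.
by case/orP: (lamE x) => /eqP lx'; [rewrite lx' eqxx in lx|rewrite ly lx' eqxx in lxy].
Qed.

Lemma cluster_cube (R : realType) (I : eqType) (M : R) (z : nat -> I -> R) :
  (forall k i, `|z k i| <= M) ->
  exists w : I -> R, forall (s : seq I) (e : R) (k0 : nat), 0 < e ->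
  exists2 k, (k0 <= k)%N & forall i, i \in s -> `|w i - z k i| < e.
Proof.
move=> zM.
have cA := @tychonoff I (fun _ => R) (fun _ => `[- M, M]%classic)
  (fun _ => @segment_compact R (- M) M).
have [|w [_ wz]] := cA (z @ \oo) _.
  by exists 0%N => // k _ i /=; rewrite in_itv /= -ler_norml.
exists w => s e k0 e0.
have nw : nbhs w [set f : forall _ : I, R | forall i, i \in s -> `|w i - f i| < e].
  elim: s => [|i s IH]; first by apply: filterS filterT.
  have ni : nbhs w (proj i @^-1` ball (w i) e).
    exact: (@proj_continuous I (fun=> R) i w _ (nbhsx_ballx _ _ e0)).
  apply: filterS (filterI ni IH) => f [/= h1 h2] j.
  by rewrite inE => /predU1P[->|]; [exact: h1|exact: h2].
have [|f [[k k0k <-] fs]] := wz [set z k | k in [set k | (k0 <= k)%N]] _ _ nw.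
  by exists k0 => // k /= k0k; exists k.
by exists k.
Qed.

(** * Schauder's theorem for Lipschitz functions *)

Section LipschitzSchauder.
Variables (R : realType) (I : eqType) (D : set I) (d : I -> I -> R) (M : R).
Hypotheses (M_gt0 : 0 < M) (d_refl : forall i, d i i = 0)
  (d_sym : forall i j, d i j = d j i)
  (d_triangle : forall i j k, d i k <= d i j + d j k).
Hypothesis D_totally_bounded : forall e : R, 0 < e ->
  exists2 s : seq I, (forall j, j \in s -> D j) &
    forall i, D i -> exists2 j, j \in s & d i j <= e.

(** The constraints bear only on D, so that a function on a subset of I need not
    be given as a function on a subtype. *)
Definition lipschitz_ball : set (I -> R) := [set z |
  (forall i, D i -> `|z i| <= M) /\
  (forall i j, D i -> D j -> `|z i - z j| <= d i j)].

Let d_ge0 i j : 0 <= d i j.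
Proof. by have := d_triangle i j i; rewrite d_refl (d_sym j); lra. Qed.

Section McShane.
Variables (n : nat) (t : 'I_n -> I).

(** McShane's extension to I of the values y at the points t j, cut off at M: the
    largest function below M and below every cone y j + d (t j) i. *)
Definition mcshane (y : 'I_n -> R) (i : I) : R :=
  \big[Num.min/M]_(j < n) (y j + d (t j) i).

Lemma mcshane_leM y i : mcshane y i <= M.
Proof. exact: bigmin_le_id. Qed.

Lemma mcshane_le y i j : mcshane y i <= y j + d (t j) i.
Proof. exact: bigmin_le. Qed.

Lemma le_mcshane y i c : c <= M -> (forall j, c <= y j + d (t j) i) ->
  c <= mcshane y i.
Proof. by move=> cM cy; apply: le_bigmin. Qed.

Lemma mcshane_bound y i : (forall j, `|y j| <= M) -> `|mcshane y i| <= M.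
Proof.
move=> yM; rewrite ler_norml mcshane_leM andbT; apply: le_mcshane => [|j].
  by have := M_gt0; lra.
by have := yM j; have := d_ge0 (t j) i; rewrite ler_norml => ? /andP[]; lra.
Qed.

Lemma mcshane_lipschitz y i i' : `|mcshane y i - mcshane y i'| <= d i i'.
Proof.
have h a b : mcshane y a - d a b <= mcshane y b.
  apply: le_mcshane => [|j]; first by have := mcshane_leM y a; have := d_ge0 a b; lra.
  by have := mcshane_le y a j; have := d_triangle (t j) b a; rewrite (d_sym b a); lra.
by have := h i i'; have := h i' i; rewrite (d_sym i' i) ler_norml => ? ?; apply/andP; split; lra.
Qed.

Lemma mcshane_nonexpansive y y' e i : 0 <= e ->
  (forall j, `|y j - y' j| <= e) -> `|mcshane y i - mcshane y' i| <= e.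
Proof.
move=> e0 yy.
have h a b : (forall j, `|a j - b j| <= e) -> mcshane a i - e <= mcshane b i.
  move=> ab; apply: le_mcshane => [|j]; first by have := mcshane_leM a i; lra.
  by have := mcshane_le a i j; have := ab j; rewrite ler_norml => /andP[]; lra.
have h1 := h _ _ yy; have h2 : mcshane y' i - e <= mcshane y i.
  by apply: h => j; rewrite distrC.
by rewrite ler_norml; apply/andP; split; lra.
Qed.

(** The defect e allows for values that are Lipschitz only up to an error, as are
    those of an approximate fixed point. *)
Lemma mcshane_interpolates y e j : 0 <= e -> y j <= M ->
  (forall k, y j <= y k + d (t k) (t j) + e) -> `|mcshane y (t j) - y j| <= e.
Proof.
move=> e0 yM yL; have := mcshane_le y (t j) j; rewrite d_refl addr0 => h.
have : y j - e <= mcshane y (t j).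
  by apply: le_mcshane => [|k]; [lra|have := yL k; lra].
by move=> ?; rewrite ler_norml; apply/andP; split; lra.
Qed.

End McShane.

Variable F : (I -> R) -> I -> R.
Hypothesis F_ball : forall z, lipschitz_ball z -> lipschitz_ball (F z).
Hypothesis F_cont : forall e : R, 0 < e -> exists2 del : R, 0 < del &
  forall z z', lipschitz_ball z -> lipschitz_ball z' ->
  (forall i, D i -> `|z i - z' i| <= del) ->
  forall i, D i -> `|F z i - F z' i| <= e.

(** Brouwer is applied to the values at a finite net of the image of their McShane
    extension. The resulting y is Lipschitz up to 2 e', since F (mcshane t y) is
    Lipschitz and e'-close to y on the net; so the extension nearly interpolates
    y, and both sides being Lipschitz the estimate spreads from the net to D. *)
Lemma approx_schauder (e : R) : 0 < e -> exists z, [/\ lipschitz_ball z,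
  (forall i, `|z i| <= M) & (forall i, D i -> `|F z i - z i| <= e)].
Proof.
move=> e0; (* One e' for Brouwer, two for the interpolation, and one for moving each of the
   two functions from i to the net. *)
pose e' := e / 5; have e'0 : 0 < e' by rewrite /e'; lra.
have [s sD sP] := D_totally_bounded e'0.
pose n := size s; pose t (j : 'I_n) := tnth (in_tuple s) j.
have tD j : D (t j) by apply: sD; rewrite mem_tnth.
have Eball y : (forall j, `|y j| <= M) -> lipschitz_ball (mcshane t y).
  by move=> yM; split=> [i _|i j _ _]; [exact: mcshane_bound|exact: mcshane_lipschitz].
pose f y (j : 'I_n) := F (mcshane t y) (t j).
have [||y yM fy] := @approx_brouwer R n M f M_gt0 _ _ e' e'0.
- by move=> y yM i; have [FM _] := F_ball (Eball _ yM); exact: FM.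
- move=> e1 e10; have [del del0 Fd] := F_cont e10.
  exists del => // y y' yM y'M yy i; apply: Fd => //; try exact: Eball.
  by move=> k _; apply: mcshane_nonexpansive => //; exact: ltW.
exists (mcshane t y); split => [||i iD]; first exact: Eball.
  by move=> i; exact: mcshane_bound.
have [_ FL] := F_ball (Eball _ yM); have [_ EL] := Eball _ yM.
have [j0 j0s dij] := sP i iD.
have /tnthP[j ej] : j0 \in in_tuple s := j0s.
have {}dij : d i (t j) <= e' by rewrite /t -ej.
have tj : `|mcshane t y (t j) - y j| <= e' *+ 2.
  apply: mcshane_interpolates; first by rewrite mulrn_wge0// ltW.
    by rewrite (le_trans (ler_norm _)).
  move=> k; have := fy k; have := fy j; have := FL (t k) (t j) (tD k) (tD j).
  rewrite !ler_norml /f => /andP[h1 h2] /andP[h3 h4] /andP[h5 h6].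
  rewrite mulr2n; lra.
have := fy j; have := FL i (t j) iD (tD j); have := EL i (t j) iD (tD j).
move: tj; rewrite !ler_norml mulr2n /f => /andP[? ?] /andP[? ?] /andP[? ?] /andP[? ?].
have : e = e' + e' + e' + e' + e' by rewrite /e'; field.
by move=> ?; apply/andP; split; lra.
Qed.

(** A pointwise cluster point of approximate fixed points is a fixed point: being
    close on a finite net, two functions of the ball are uniformly close, so that
    F may be compared at them. *)
Theorem schauder_lipschitz : exists2 z, lipschitz_ball z & forall i, D i -> F z i = z i.
Proof.
have [z zP] := choice (fun k : nat => @approx_schauder k.+1%:R^-1 (ltac:(by rewrite invr_gt0 ltr0n))).
have [w wP] := @cluster_cube R I M z (fun k => (let: And3 _ h _ := zP k in h)).
have wball : lipschitz_ball w.
  split=> [i iD|i j iD jD]; apply/ler_addgt0Pr => e e0.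
    have [k _ /(_ i (mem_head _ _)) wz] := wP [:: i] e 0%N e0.
    have [_ /(_ i) zM _] := zP k.
    by rewrite -(subrK (z k i) (w i)) (le_trans (ler_normD _ _))//; lra.
  have e20 : 0 < e / 2 by lra.
  have [k _ wz] := wP [:: i; j] _ 0%N e20.
  have wi := wz i (mem_head _ _); have wj : `|w j - z k j| < e / 2.
    by apply: wz; rewrite !inE eqxx orbT.
  have [[_ /(_ i j iD jD) zL] _ _] := zP k.
  have -> : w i - w j = (w i - z k i) - (w j - z k j) + (z k i - z k j) by ring.
  rewrite (le_trans (ler_normD _ _))// addrC lerD//.
  by rewrite (le_trans (ler_normB _ _))//; lra.
exists w => // i iD; apply/eqP; rewrite -subr_eq0 -normr_le0.
apply/ler_addgt0Pr => e e0; rewrite add0r.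
have e30 : 0 < e / 3 by lra.
have [del del0 Fd] := F_cont e30.
pose eta := Num.min (del / 3) (e / 3).
have eta0 : 0 < eta by rewrite lt_min e30 andbT; lra.
have [etad etae] : eta <= del / 3 /\ eta <= e / 3.
  by apply/andP; rewrite -le_min.
have [s sD sP] := D_totally_bounded eta0.
have [k k0k wz] := wP (i :: s) eta (Num.trunc (e / 3)^-1) eta0.
have [zball _ Fz] := zP k.
have kk : k.+1%:R^-1 <= e / 3.
  rewrite invf_ple ?posrE ?ltr0n//; apply/ltW/(lt_le_trans (truncnS_gt _)).
  by rewrite ler_nat ltnS.
have h1 : `|F w i - F (z k) i| <= e / 3.
  apply: Fd => // l lD; have [j js dlj] := sP l lD.
  have wj : `|w j - z k j| < eta by apply: wz; rewrite inE js orbT.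
  have := wball.2 l j lD (sD j js); have := zball.2 l j lD (sD j js).
  have -> : w l - z k l = (w l - w j) + (w j - z k j) - (z k l - z k j) by ring.
  move=> ? ?; rewrite (le_trans (ler_normB _ _))//.
  by rewrite (le_trans (lerD (ler_normD _ _) (lexx _)))//; lra.
have h2 := le_trans (Fz i iD) kk; have h3 := wz i (mem_head _ _).
have -> : F w i - w i = (F w i - F (z k) i) + (F (z k) i - z k i) - (w i - z k i) by ring.
rewrite (le_trans (ler_normB _ _))//.
by rewrite (le_trans (lerD (ler_normD _ _) (lexx _)))//; lra.
Qed.

End LipschitzSchauder.

(** * Differential calculus on time scales *)

Section TimeScaleCalculus.
Variables (R : realType) (TS : set R).
Implicit Types (f F : R -> R) (s t d e : R).

Lemma closed_approx t : closed TS ->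
  (forall e, 0 < e -> exists2 s, TS s & `|s - t| < e) -> TS t.
Proof.
move=> /closure_id cT h; rewrite cT => U /nbhs_ballP[e /= e0 eU].
by have [s Ts st] := h e e0; exists s; split => //; apply: eU; rewrite /ball /= distrC.
Qed.

Lemma within_near t (P : R -> Prop) :
  (\forall s \near within TS (nbhs t), P s) <->
  exists2 e, 0 < e & forall s, TS s -> `|s - t| < e -> P s.
Proof.
split=> [/nbhs_ballP[e /= e0 eP]|[e e0 eP]].
  by exists e => // s Ts st; apply: eP => //; rewrite /ball /= distrC.
by apply/nbhs_ballP; exists e => // s; rewrite /ball /= distrC => st Ts; exact: eP.
Qed.

Lemma within_continuousP f : {within TS, continuous f} <->
  forall t, TS t -> forall e, 0 < e -> exists2 del, 0 < del &
    forall s, TS s -> `|s - t| < del -> `|f s - f t| < e.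
Proof.
split=> [/subspace_continuousP fc t Tt e e0|fc].
  have /within_near := fc t Tt _ (nbhsx_ballx (f t) e e0).
  by case=> del del0 h; exists del => // s Ts st; have := h s Ts st; rewrite /= distrC.
apply/subspace_continuousP => t Tt U /nbhs_ballP[e /= e0 eU].
have [del del0 h] := fc t Tt e e0.
apply/within_near; exists del => // s Ts st; apply: eU.
by rewrite /ball /= distrC h.
Qed.

Lemma is_delta_derivativeP f t d : is_delta_derivative TS f t d <->
  forall e, 0 < e -> exists2 del, 0 < del & forall s, TS s -> `|s - t| < del ->
   `|f (forward_jump TS t) - f s - d * (forward_jump TS t - s)|
      <= e * `|forward_jump TS t - s|.
Proof. by split=> h e e0; apply/within_near/h. Qed.

Hypothesis TS_closed : closed TS.
Hypothesis TS_above : forall t, exists2 s, TS s & t < s.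
Local Notation sigma := (forward_jump TS).

Lemma forward_jump_set_has_inf t : has_inf [set s | TS s /\ t < s].
Proof.
split; first by have [s Ts ts] := TS_above t; exists s.
by exists t => s [_ /ltW].
Qed.

Lemma forward_jump_ge t : t <= sigma t.
Proof.
apply: lb_le_inf; first by have [] := forward_jump_set_has_inf t.
by move=> s [_ /ltW].
Qed.

Lemma forward_jump_le t s : TS s -> t < s -> sigma t <= s.
Proof. by move=> Ts ts; apply: ge_inf => //; have [] := forward_jump_set_has_inf t. Qed.

Lemma forward_jump_adherent t e : 0 < e -> exists s, [/\ TS s, t < s & s < sigma t + e].
Proof.
by move=> e0; have [s [Ts ts] se] := inf_adherent e0 (forward_jump_set_has_inf t); exists s.
Qed.

Lemma forward_jump_in t : TS (sigma t).
Proof.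
apply: closed_approx => // e e0; have [s [Ts ts se]] := forward_jump_adherent t e0.
exists s => //; rewrite ger0_norm; first lra.
by rewrite subr_ge0 forward_jump_le.
Qed.

(** There are points s of TS, arbitrarily near t, with s <> sigma t: the point t
    itself if it is right-scattered, points on its right otherwise. *)
Lemma delta_derivative_unique f t d d' : TS t ->
  is_delta_derivative TS f t d -> is_delta_derivative TS f t d' -> d = d'.
Proof.
move=> Tt /is_delta_derivativeP fd /is_delta_derivativeP fd'.
apply/eqP; rewrite -subr_eq0 -normr_le0; apply/ler_addgt0Pr => e e0; rewrite add0r.
have e20 : 0 < e / 2 by lra.
have [a a0 ha] := fd _ e20; have [b b0 hb] := fd' _ e20.
have [s [Ts st ss]] : exists s, [/\ TS s, `|s - t| < Num.min a b & s != sigma t].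
  have ab0 : 0 < Num.min a b by rewrite lt_min a0.
  have [ts|] := eqVneq t (sigma t); last by exists t; rewrite subrr normr0.
  have [s [Ts lts se]] := forward_jump_adherent t ab0.
  exists s; split => //; last by rewrite -ts gt_eqF.
  by rewrite -ts in se; rewrite ger0_norm ?subr_ge0 ?ltW//; lra.
move: st; rewrite lt_min => /andP[sa sb].
have := ha s Ts sa; have := hb s Ts sb.
set X := f _ - f s; set Y := _ - s => h1 h2.
have Y0 : 0 < `|Y| by rewrite normr_gt0 subr_eq0 eq_sym.
rewrite -(ler_pM2r Y0) -normrM.
have -> : (d - d') * Y = (X - d' * Y) - (X - d * Y) by ring.
by rewrite (le_trans (ler_normB _ _))//; lra.
Qed.

Lemma delta_derivativeE f t d : TS t -> is_delta_derivative TS f t d ->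
  delta_derivative TS f t = d.
Proof. by move=> Tt fd; apply: xget_unique => // d' /(delta_derivative_unique Tt fd). Qed.

Lemma eq_delta_derivative f g t d : TS t -> (forall s, TS s -> f s = g s) ->
  is_delta_derivative TS f t d -> is_delta_derivative TS g t d.
Proof.
move=> Tt fg /is_delta_derivativeP fd; apply/is_delta_derivativeP => e /fd[del del0 h].
exists del => // s Ts st; rewrite -!fg//; first exact: h.
exact: forward_jump_in.
Qed.

Lemma is_delta_derivativeD f g t d d' : is_delta_derivative TS f t d ->
  is_delta_derivative TS g t d' -> is_delta_derivative TS (fun s => f s + g s) t (d + d').
Proof.
move=> fd gd e e0; have e20 : 0 < e / 2 by lra.
apply: filterS2 (fd _ e20) (gd _ e20) => s h1 h2.
set X := sigma t in h1 h2 *.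
have -> : f X + g X - (f s + g s) - (d + d') * (X - s) =
  (f X - f s - d * (X - s)) + (g X - g s - d' * (X - s)) by ring.
by rewrite (le_trans (ler_normD _ _))//; lra.
Qed.

Lemma is_delta_derivativeZ f t d c : is_delta_derivative TS f t d ->
  is_delta_derivative TS (fun s => c * f s) t (c * d).
Proof.
move=> fd e e0.
have c0 : 0 < `|c| + 1 by have := normr_ge0 c; lra.
apply: filterS (fd _ (divr_gt0 e0 c0)) => s h.
set X := sigma t in h *.
have -> : c * f X - c * f s - c * d * (X - s) = c * (f X - f s - d * (X - s)) by ring.
rewrite normrM (le_trans (ler_wpM2l (normr_ge0 _) h))// mulrA ler_wpM2r//.
rewrite mulrA ler_pdivrMr// mulrC ler_pM2l//; lra.
Qed.

Lemma is_delta_derivativeB f g t d d' : is_delta_derivative TS f t d ->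
  is_delta_derivative TS g t d' -> is_delta_derivative TS (fun s => f s - g s) t (d - d').
Proof.
move=> fd gd.
have := is_delta_derivativeD fd (is_delta_derivativeZ (-1) gd).
by under eq_fun do rewrite mulN1r; rewrite mulN1r.
Qed.

Lemma is_delta_derivative_cst c t : is_delta_derivative TS (fun=> c) t 0.
Proof.
by move=> e e0; apply: nearW => s; rewrite subrr mul0r subrr normr0 mulr_ge0// ltW.
Qed.

Lemma is_delta_derivative_id t : is_delta_derivative TS id t 1.
Proof.
by move=> e e0; apply: nearW => s; rewrite mul1r subrr normr0 mulr_ge0// ltW.
Qed.

Lemma forward_jump_shift b t : (forall s, TS s <-> TS (s + b)) ->
  sigma (t + b) = sigma t + b.
Proof.
have h b' t' : (forall s, TS s <-> TS (s + b')) -> sigma t' + b' <= sigma (t' + b').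
  move=> Tb; apply: lb_le_inf; first by have [] := forward_jump_set_has_inf (t' + b').
  move=> s [Ts ts]; rewrite -lerBrDr forward_jump_le//; last lra.
  by apply/Tb; rewrite subrK.
move=> Tb; apply/eqP; rewrite eq_le h// andbT.
have := h (- b) (t + b); rewrite addrK => h'.
rewrite -lerBlDr; apply: h' => s.
by split=> Ts; [apply/Tb; rewrite subrK|move/Tb: Ts; rewrite subrK].
Qed.

Lemma is_delta_derivative_shift f b t d : (forall s, TS s <-> TS (s + b)) ->
  is_delta_derivative TS f (t + b) d ->
  is_delta_derivative TS (fun s => f (s + b)) t d.
Proof.
move=> Tb /is_delta_derivativeP fd; apply/is_delta_derivativeP => e /fd[del del0 h].
exists del => // s Ts st; have := h (s + b) ((Tb s).1 Ts).
rewrite forward_jump_shift// !opprD !addrA [s + b - t - b]addrAC addrK.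
by rewrite [sigma t + b - s - b]addrAC addrK; apply.
Qed.

(** The estimates at s and at t itself are subtracted; both involve the graininess
    m, which is why e1 is taken small against 2 m + 1. *)
Lemma is_delta_derivative_continuous f t d : is_delta_derivative TS f t d ->
  TS t -> forall e, 0 < e -> exists2 del, 0 < del &
    forall s, TS s -> `|s - t| < del -> `|f s - f t| < e.
Proof.
move=> /is_delta_derivativeP fd Tt e e0.
pose m := sigma t - t; have m0 : 0 <= m by rewrite subr_ge0 forward_jump_ge.
have e10 : 0 < e / (2 * (2 * m + 1)) by rewrite divr_gt0//; lra.
have [a a0 ha] := fd _ e10; set e1 := _ / _ in e10 ha.
have e1E : e1 * (2 * m + 1) = e / 2 by rewrite /e1; field; lra.
have d0 : 0 < `|d| + 1 by have := normr_ge0 d; lra.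
pose del := Num.min (Num.min a 1) (e / (2 * (`|d| + 1))).
exists del.
  by rewrite /del !lt_min a0 ltr01 divr_gt0// mulr_gt0.
move=> s Ts; rewrite /del !lt_min => /andP[/andP[sa s1] sd].
have h1 := ha s Ts sa; have := ha t Tt; rewrite subrr normr0 => /(_ a0) h2.
have h3 : `|sigma t - s| <= m + 1.
  rewrite (_ : _ - s = m - (s - t)) ?(le_trans (ler_normB _ _))//; last by rewrite /m; ring.
  by rewrite (ger0_norm m0); lra.
have h4 : e1 * `|sigma t - s| <= e1 * (m + 1) by rewrite ler_pM2l.
rewrite -/m (ger0_norm m0) in h2.
have h5 : `|d| * `|s - t| < e / 2.
  apply: (@le_lt_trans _ _ ((`|d| + 1) * `|s - t|)).
    by rewrite ler_wpM2r//; lra.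
  by rewrite mulrC -ltr_pdivlMr// -mulrA -invfM.
have -> : f s - f t = (f (sigma t) - f t - d * m)
   - (f (sigma t) - f s - d * (sigma t - s)) + d * (s - t) by rewrite /m; ring.
have := ler_normD (f (sigma t) - f t - d * m
   - (f (sigma t) - f s - d * (sigma t - s))) (d * (s - t)).
have := ler_normB (f (sigma t) - f t - d * m) (f (sigma t) - f s - d * (sigma t - s)).
rewrite (normrM d (s - t)).
lra.
Qed.

(** With slope c + e in place of c, let tau be the supremum of the points of
    [s, t] whose increment from s is as claimed. If tau < t, the derivative at tau,
    used at points on the left of tau, shows that sigma tau is such a point; thus
    sigma tau = tau, and then points on the right of tau are such points too, a
    contradiction. If tau = t, the claim follows by continuity. *)
Lemma delta_mean_value F f c s t : delta_antiderivative TS F f ->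
  (forall u, TS u -> f u <= c) -> TS s -> TS t -> s <= t ->
  F t - F s <= c * (t - s).
Proof.
move=> Ff fc Ts Tt st; apply/ler_addgt0Pr => eta eta0.
pose e := eta / (2 * (t - s + 1)).
have e0 : 0 < e by rewrite /e divr_gt0//; lra.
have eE : e * (t - s) <= eta / 2.
  have : e * (t - s + 1) = eta / 2 by rewrite /e; field; lra.
  by lra.
pose G := [set u | [/\ TS u, s <= u, u <= t & F u - F s <= (c + e) * (u - s)]].
have Gs : G s by split => //; rewrite !subrr mulr0.
have hG : has_sup G by split; [exists s|exists t => u []].
set tau := sup G.
have stau : s <= tau by apply: ub_le_sup => //; case: hG.
have taut : tau <= t by apply: ge_sup; [exists s|move=> u []].
have Gadh a : 0 < a -> exists u, [/\ G u, u <= tau & tau - a < u].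
  move=> a0; have [u Gu ua] := sup_adherent a0 hG.
  by exists u; split => //; apply: ub_le_sup => //; case: hG.
have Ttau : TS tau.
  apply: closed_approx => // a /Gadh[u [[Tu _ _ _] ut ua]]; exists u => //.
  by rewrite distrC ger0_norm ?subr_ge0//; lra.
have /is_delta_derivativeP/(_ _ e0)[del del0 hd] := Ff _ Ttau.
have ctau := fc _ Ttau.
have [tt|tt] := ltP tau t.
  have sle : sigma tau <= t := forward_jump_le Tt tt.
  have sge := forward_jump_ge tau.
  have [u [[Tu su ut Fu] utau udel]] := Gadh _ del0.
  have := hd u Tu; rewrite distrC (ger0_norm (_ : 0 <= tau - u)) ?subr_ge0//.
  move=> /(_ (ltac:(lra))); rewrite (ger0_norm (_ : 0 <= sigma tau - u)); last lra.
  rewrite ler_norml => /andP[_ h1].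
  have h2 : f tau * (sigma tau - u) <= c * (sigma tau - u) by rewrite ler_wpM2r//; lra.
  have Gsig : G (sigma tau).
    split => //; [exact: forward_jump_in|lra|].
    have -> : (c + e) * (sigma tau - s) = (c + e) * (u - s) + c * (sigma tau - u)
       + e * (sigma tau - u) by ring.
    lra.
  have sig : sigma tau = tau.
    by apply/eqP; rewrite eq_le sge andbT; apply: ub_le_sup => //; case: hG.
  have d10 : 0 < Num.min del (t - tau) by rewrite lt_min del0 subr_gt0.
  have [v [Tv tauv]] := forward_jump_adherent tau d10.
  rewrite sig -ltrBlDl lt_min => /andP[vd vt].
  have := hd v Tv; rewrite ger0_norm ?subr_ge0 ?(ltW tauv)// => /(_ vd).
  rewrite sig (distrC tau v) (ger0_norm (_ : 0 <= v - tau)) ?subr_ge0 ?(ltW tauv)//.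
  rewrite ler_norml => /andP[h3 _].
  have h4 : f tau * (v - tau) <= c * (v - tau) by rewrite ler_wpM2r//; lra.
  have [_ _ _ h5] : G tau by rewrite -sig.
  have : v <= tau.
    apply: ub_le_sup; first by case: hG.
    split => //; [lra|lra|].
    have -> : (c + e) * (v - s) = (c + e) * (tau - s) + c * (v - tau) + e * (v - tau) by ring.
    by lra.
  by rewrite leNgt tauv.
have {tt} tE : tau = t by apply/eqP; rewrite eq_le taut.
have eta4 : 0 < eta / 4 by lra.
have [del1 del10 hc] := is_delta_derivative_continuous (Ff _ Tt) Tt eta4.
have k0 : 0 < `|c + e| + 1 by have := normr_ge0 (c + e); lra.
have [|u [[Tu su ut Fu] _ ud]] := Gadh (Num.min del1 (eta / 4 / (`|c + e| + 1))).
  by rewrite lt_min del10 divr_gt0.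
rewrite tE in ud.
have {ud} : t - u < Num.min del1 (eta / 4 / (`|c + e| + 1)) by lra.
rewrite lt_min => /andP[ud1 ud2].
have := hc u Tu; rewrite distrC ger0_norm ?subr_ge0// => /(_ ud1).
rewrite ltr_norml => /andP[h1 _].
have h2 : - ((c + e) * (t - u)) <= eta / 4.
  rewrite (le_trans (ler_norm _))// normrN normrM (ger0_norm (_ : 0 <= t - u)) ?subr_ge0//.
  apply: (@le_trans _ _ ((`|c + e| + 1) * (t - u))).
    by rewrite ler_wpM2r ?subr_ge0//; lra.
  by rewrite mulrC -ler_pdivlMr// ltW.
have -> : c * (t - s) = (c + e) * (u - s) + (c + e) * (t - u) - e * (t - s) by ring.
lra.
Qed.

Lemma delta_mean_value_norm F f c s t : delta_antiderivative TS F f ->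
  (forall u, TS u -> `|f u| <= c) -> TS s -> TS t ->
  `|F t - F s| <= c * `|t - s|.
Proof.
move=> Ff fc; wlog st : s t / s <= t => [h Ts Tt|Ts Tt].
  have [/h|/ltW/h] := leP s t; first exact.
  by rewrite distrC [X in _ <= _ * X]distrC; apply.
have h1 := delta_mean_value Ff (fun u Tu => le_trans (ler_norm _) (fc u Tu)) Ts Tt st.
have Ff' : delta_antiderivative TS (fun t => -1 * F t) (fun t => -1 * f t).
  by move=> u Tu; apply: is_delta_derivativeZ; exact: Ff.
have := delta_mean_value Ff' _ Ts Tt st (c := c).
rewrite (ger0_norm (_ : 0 <= t - s)) ?subr_ge0// ler_norml => h2; apply/andP; split => //.
have {h2} : -1 * F t - -1 * F s <= c * (t - s).
  by apply: h2 => u Tu; rewrite mulN1r (le_trans (ler_norm _))// normrN fc.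
lra.
Qed.

Lemma delta_integralE F f a b : delta_antiderivative TS F f -> TS a -> TS b ->
  delta_integral TS f a b = F b - F a.
Proof.
move=> Ff Ta Tb; apply: xget_unique; first by exists F.
move=> v [G Gf ->].
have GF : delta_antiderivative TS (fun t => G t - F t) (fun=> 0).
  by move=> t Tt; rewrite -(subrr (f t)); apply: is_delta_derivativeB; [exact: Gf|exact: Ff].
have h0 (u : R) : TS u -> `|0 : R| <= 0 by rewrite normr0.
have := delta_mean_value_norm GF h0 Ta Tb.
by rewrite mul0r normr_le0 subr_eq0 => /eqP e; lra.
Qed.

Lemma eq_delta_integral f g a b : (forall t, TS t -> f t = g t) ->
  delta_integral TS f a b = delta_integral TS g a b.
Proof.
move=> fg; rewrite /delta_integral; congr xget; apply/funext => v; apply/propext.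
by split=> -[F Ff ->]; exists F => // t Tt; have := Ff t Tt; rewrite fg.
Qed.

End TimeScaleCalculus.

(** * Existence of delta antiderivatives *)

Lemma continuous_bounded_on (R : realType) (A : set R) (f : R -> R) :
  compact A -> {within A, continuous f} ->
  exists2 B, 0 < B & forall x, A x -> `|f x| <= B.
Proof.
move=> cA fc; have [B [_ BP]] := compact_bounded (continuous_compact fc cA).
exists (`|B| + 1); first by have := normr_ge0 B; lra.
move=> x Ax; apply: (BP (`|B| + 1)); last by exists x.
by rewrite (le_lt_trans (ler_norm _))// ltrDl.
Qed.

Lemma continuous_bounded_ball (R : realType) (X : R) (f : R -> R) :
  continuous f -> exists2 B, 0 < B & forall x, `|x| <= X -> `|f x| <= B.
Proof.
move=> fc; have [B B0 fB] := @continuous_bounded_on _ `[- X, X] f (@segment_compact _ _ _)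
  (continuous_subspaceT fc).
by exists B => // x xX; apply: fB; rewrite /= in_itv /= -ler_norml.
Qed.

(** The point y is not confined to the ball; near_covering compactness gives the
    uniform modulus from the pointwise ones. *)
Lemma heine (R : realType) (f : R -> R) (X e : R) : continuous f -> 0 < e ->
  exists2 del, 0 < del &
    forall x y, `|x| <= X -> `|x - y| <= del -> `|f x - f y| <= e.
Proof.
move=> fc e0.
have /compact_near_coveringP := @segment_compact R (- X) X.
move=> /(_ _ (0 : R)^'+ (fun del x => forall y, `|x - y| <= del -> `|f x - f y| <= e) _).
case=> [x _|/= del del0 /= h].
  have /nbhs_ballP[eta /= eta0 fe] := fc x _ (nbhsx_ballx (f x) (e / 2) (ltac:(by lra))).
  have e20 : 0 < eta / 2 by lra.
  exists (ball x (eta / 2), [set del | del < eta / 2]).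
    by split; [exact: nbhsx_ballx|exact: nbhs_right_lt].
  move=> [u v] /= [xu vd] y uy.
  have fu : ball (f x) (e / 2) (f u).
    by apply: fe; apply: le_ball xu; lra.
  have fy : ball (f x) (e / 2) (f y).
    apply: fe; rewrite /ball /= in xu *.
    by rewrite -(subrKA u) (le_lt_trans (ler_normD _ _))//; lra.
  rewrite /ball /= in fu fy; rewrite -(subrKA (f x)) (le_trans (ler_normD _ _))//.
  by rewrite distrC; lra.
exists (del / 2); first by lra.
move=> x y xX xy; apply: (h (del / 2)) => //=; last by rewrite in_itv /= -ler_norml.
  by rewrite sub0r normrN ger0_norm; lra.
by lra.
Qed.

Section DeltaAntiderivative.
Variables (R : realType) (TS : set R).
Hypotheses (TS_closed : closed TS)
  (TS_above : forall t, exists2 s, TS s & t < s)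
  (TS_below : forall t, exists2 s, TS s & s <= t).
Local Notation sigma := (forward_jump TS).
Local Notation mu := (@lebesgue_measure R).

(** The last point of TS up to t. It is constant on each gap, so integrating
    f (floor_ts t) weights the left end of a gap by its length, as the delta
    integral does. *)
Definition floor_ts (t : R) : R := sup [set s | TS s /\ s <= t].

Let floor_has_sup t : has_sup [set s | TS s /\ s <= t].
Proof.
split; first by have [s Ts st] := TS_below t; exists s.
by exists t => s [].
Qed.

Lemma floor_ts_le t : floor_ts t <= t.
Proof. by apply: ge_sup => [|s []//]; have [] := floor_has_sup t. Qed.

Lemma floor_ts_ge s t : TS s -> s <= t -> s <= floor_ts t.
Proof. by move=> Ts st; apply: ub_le_sup => //; have [] := floor_has_sup t. Qed.

Lemma floor_ts_in t : TS (floor_ts t).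
Proof.
apply: closed_approx => // e e0; have [s [Ts st] se] := sup_adherent e0 (floor_has_sup t).
exists s => //; rewrite distrC ger0_norm; first by rewrite /floor_ts; lra.
by rewrite subr_ge0 floor_ts_ge.
Qed.

Lemma floor_ts_homo : {homo floor_ts : s t / s <= t}.
Proof.
move=> s t st; apply: floor_ts_ge; first exact: floor_ts_in.
exact: le_trans (floor_ts_le s) st.
Qed.

Variable f : R -> R.
Hypothesis f_cont : {within TS, continuous f}.
Let phi (t : R) := f (floor_ts t).

Let phi_meas : measurable_fun setT phi.
Proof.
have mTS : measurable TS by exact: closed_measurable.
apply: (measurable_comp mTS) => [_ [t _ <-]| | ]; first exact: floor_ts_in.
  exact: subspace_continuous_measurable_fun.
by apply: nondecreasing_measurable => //; exact: floor_ts_homo.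
Qed.

Let bounded_int (g : R -> R) (i : interval R) a b B : measurable_fun setT g ->
  (forall x, a <= x <= b -> `|g x| <= B) -> [set` i] `<=` `[a, b] ->
  mu.-integrable [set` i] (EFin \o g).
Proof.
move=> mg gB iab; suff int_ab : mu.-integrable `[a, b] (EFin \o g).
  by apply: integrableS int_ab.
apply: measurable_bounded_integrable => //.
- suff h : (lebesgue_measure (`[a, b]%classic : set R) < +oo)%E by exact: h.
  by rewrite lebesgue_measure_itv /=; case: ifP => // _; rewrite -EFinB ltry.
- exact: measurable_funS mg.
- exists B; split; first exact: num_real.
  move=> C BC x /=; rewrite in_itv /= => xab.
  by rewrite (le_trans _ (ltW BC))//; exact: gB.
Qed.

Let phi_int (i : interval R) a b : [set` i] `<=` `[a, b] ->
  mu.-integrable [set` i] (EFin \o phi).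
Proof.
have cA : compact (`[floor_ts a, b] `&` TS).
  by apply: compact_closedI => //; exact: segment_compact.
have [B B0 fB] := continuous_bounded_on cA
  (continuous_subspaceW (@subIsetr _ _ _) f_cont).
apply: (bounded_int (B := B)) => // x /andP[ax xb].
apply: fB; split; last exact: floor_ts_in.
by rewrite /= in_itv /= floor_ts_homo//= (le_trans (floor_ts_le _) xb).
Qed.

Let J (a b : R) : R := \int[mu]_(x in `[a, b]) phi x.

Let J_chasles a b c : a <= b -> b <= c -> J a b + J b c = J a c.
Proof.
move=> ab bc; rewrite /J -(@Rintegral_itv_obnd_cbnd _ b).
  rewrite -(@Rintegral_itvB _ _ (BLeft a) (BRight c) b) ?bnd_simp//.
    by rewrite addrC subrK.
  by apply: (@phi_int _ a c).
by apply: (@phi_int _ b c); exact: subset_itv_oc_cc.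
Qed.

Let J0 a b : b <= a -> J a b = 0.
Proof.
rewrite le_eqVlt => /predU1P[->|ba].
  by have := J_chasles (lexx a) (lexx a); lra.
by rewrite /J set_itv_ge ?Rintegral_set0// bnd_simp -ltNge.
Qed.

(** The bounds are required on the half-open interval only: its right end may be
    sigma t, where f need not be close to f t. *)
Let J_bounds a b m M : a <= b -> (forall x, a <= x < b -> m <= phi x <= M) ->
  m * (b - a) <= J a b <= M * (b - a).
Proof.
move=> ab mM; have int_ab : mu.-integrable `[a, b[ (EFin \o phi).
  by apply: (@phi_int _ a b); exact: subset_itv_co_cc.
have intc k : \int[mu]_(x in `[a, b[) k = k * (b - a).
  rewrite Rintegral_cst//; congr (_ * _).
  rewrite (_ : fine _ = fine (lebesgue_measure (`[a, b[%classic : set R)))//.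
  rewrite lebesgue_measure_itv /= lte_fin.
  case: ltP => //= ba; have -> : a = b by apply/eqP; rewrite eq_le ab.
  by rewrite subrr.
have int_cst k : mu.-integrable `[a, b[ (EFin \o (fun=> k : R)).
  by apply: (@bounded_int _ _ a b `|k|) => //; exact: subset_itv_co_cc.
rewrite /J -Rintegral_itv_bndo_bndc// -!intc; apply/andP; split;
  apply: le_Rintegral => // x /=; rewrite in_itv /= => /mM /andP[]//.
Qed.

(** For s in TS near t, every point between s and sigma t other than the larger
    of the two has its floor between s and t, where f is close to f t. *)
Lemma delta_antiderivative_exists : exists F, delta_antiderivative TS F f.
Proof.
(* One of the two intervals is empty or a point: this is the signed integral
   from 0 to t. *)
pose F t := J 0 t - J t 0; exists F.
have FB a b : a <= b -> F b - F a = J a b.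
  move=> ab; rewrite /F; have [a0|/ltW a0] := leP 0 a.
    rewrite (J0 (le_trans a0 ab)) (J0 a0) -(J_chasles a0 ab); ring.
  rewrite (J0 a0); have [b0|/ltW b0] := leP 0 b.
    by rewrite (J0 b0) -(J_chasles a0 b0); ring.
  by rewrite (J0 b0) -(J_chasles ab b0); ring.
move=> t Tt; apply/is_delta_derivativeP => e e0.
have [del del0 fd] := (within_continuousP TS f).1 f_cont t Tt e e0.
exists del => // s Ts st; have sge := forward_jump_ge TS_above t.
have near u : TS u -> `|u - t| <= `|s - t| -> f t - e <= f u <= f t + e.
  move=> Tu ut; have := fd u Tu (le_lt_trans ut st).
  by rewrite ltr_norml => /andP[h1 h2]; apply/andP; split; lra.
have [le_st|lt_ts] := leP s t.
  have ssig : s <= sigma t by lra.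
  have /andP[] : (f t - e) * (sigma t - s) <= J s (sigma t) <= (f t + e) * (sigma t - s).
    apply: J_bounds => // x /andP[sx xs]; apply: near; first exact: floor_ts_in.
    have h1 := floor_ts_ge Ts sx.
    have h2 : floor_ts x <= t.
      rewrite leNgt; apply/negP => /(forward_jump_le TS_above (floor_ts_in x)).
      by have := floor_ts_le x; lra.
    by rewrite distrC (ger0_norm (_ : 0 <= t - _)) ?subr_ge0// distrC ger0_norm ?subr_ge0//; lra.
  rewrite FB// (ger0_norm (_ : 0 <= _ - s)) ?subr_ge0// ler_norml => h1 h2.
  by apply/andP; split; lra.
have ssig : sigma t <= s := forward_jump_le TS_above Ts lt_ts.
have /andP[] : (f t - e) * (s - sigma t) <= J (sigma t) s <= (f t + e) * (s - sigma t).
  apply: J_bounds => // x /andP[sx xs]; apply: near; first exact: floor_ts_in.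
  have h1 := floor_ts_ge (forward_jump_in TS_closed TS_above t) sx.
  have h2 := floor_ts_le x.
  by rewrite !ger0_norm ?subr_ge0//; lra.
rewrite -FB// distrC (distrC _ s) (ger0_norm (_ : 0 <= s - _)) ?subr_ge0// ler_norml => h1 h2.
by apply/andP; split; lra.
Qed.

End DeltaAntiderivative.

(** * Periodic time scales *)

Section PeriodicTimeScale.
Variables (R : realType) (TS : set R) (T : R).
Implicit Types (f g : R -> R) (s t u x y z r e L B c : R).
Hypotheses (T_gt0 : 0 < T) (TS_closed : closed TS)
  (TS_per : periodic_time_scale TS T) (TS0 : TS 0).

Lemma ts_shift s : TS s <-> TS (s + T).
Proof.
split=> [Ts|]; first by rewrite -TS_per; exists s.
by rewrite -{1}TS_per => -[u Tu /addIr <-].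
Qed.

Lemma ts_shift_int (k : int) s : TS s <-> TS (s + k%:~R * T).
Proof.
have nat_case (m : nat) u : TS u <-> TS (u + m%:R * T).
  elim: m => [|m IH]; first by rewrite mul0r addr0.
  by rewrite -natr1 mulrDl mul1r addrA -ts_shift.
case: k => m; first exact: nat_case.
rewrite NegzE mulrNz mulNr; apply: iff_sym.
by have := nat_case m.+1 (s - m.+1%:R * T); rewrite subrK.
Qed.

Lemma ts_add_int (k : int) s : TS s -> TS (s + k%:~R * T).
Proof. by move/(ts_shift_int k). Qed.

Lemma ts_period : TS T.
Proof. by rewrite -[T]add0r; apply/(ts_shift 0).1. Qed.

Lemma mod_period t : 0 <= t - (Num.floor (t / T))%:~R * T < T.
Proof.
have /andP[h1 h2] := floor_itv (t / T).
rewrite ler_pdivlMr// in h1; rewrite ltr_pdivrMr// intrD mulrDl mul1r in h2.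
by apply/andP; split; lra.
Qed.

Lemma ts_above t : exists2 s, TS s & t < s.
Proof.
exists (0 + (Num.floor (t / T) + 1)%:~R * T); first exact: ts_add_int.
by have := mod_period t; rewrite intrD mulrDl mul1r add0r => /andP[]; lra.
Qed.

Lemma ts_below t : exists2 s, TS s & s <= t.
Proof.
exists (0 + (Num.floor (t / T))%:~R * T); first exact: ts_add_int.
by have := mod_period t; rewrite add0r => /andP[]; lra.
Qed.

(** Dirichlet's pigeonhole argument: among N + 2 multiples of r / T, two have
    fractional parts in the same one of N + 1 cells. *)
Lemma simultaneous_return (r e : R) : 0 < e ->
  exists (n : nat) (m : int), `|n.+1%:R * r - m%:~R * T| < e.
Proof.
move=> e0; pose N := (Num.trunc (T / e)).
have NT : T / e < N.+1%:R := truncnS_gt _.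
pose y (k : nat) := k%:R * r / T.
pose z k := y k - (Num.floor (y k))%:~R.
have zP k : 0 <= z k < 1.
  have /andP[h1 h2] := floor_itv (y k); rewrite intrD in h2.
  by rewrite /z; apply/andP; split; lra.
pose cell (k : 'I_N.+2) : 'I_N.+1 := inord (Num.trunc (z k * N.+1%:R)).
have N0 : 0 < N.+1%:R :> R by rewrite ltr0n.
have cellP k : (cell k)%:R <= z k * N.+1%:R < (cell k)%:R + 1.
  have /andP[z0 z1] := zP k.
  have z'0 : 0 <= z k * N.+1%:R by rewrite mulr_ge0// ltW.
  have /andP[h1 h2] := truncn_itv z'0.
  rewrite inordK; first by rewrite h1 /= natr1.
  rewrite -(ltr_nat R) (le_lt_trans h1)//.
  by rewrite -[ltRHS]mul1r ltr_pM2r.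
have : ~~ injectiveb cell.
  by apply/negP => /injectiveP/leq_card; rewrite !card_ord ltnn.
case/injectivePn => k [l]; wlog kl : k l / (k < l)%N => [h kl e1|_ kle].
  case: (ltngtP k l) => [/h|/h|/val_inj kl']; [exact| |by rewrite kl' eqxx in kl].
  by apply; rewrite 1?eq_sym.
exists (l - k.+1)%N, (Num.floor (y l) - Num.floor (y k))%R.
have -> : (l - k.+1).+1 = (l - k)%N by rewrite subnSK.
have /andP[k1 k2] := cellP k; have /andP[l1 l2] := cellP l; rewrite kle in k1 k2.
have zz : `|z l - z k| * N.+1%:R < 1.
  rewrite -(ger0_norm (ltW N0)) -normrM mulrBl ltr_norml.
  by apply/andP; split; lra.
have T0 : T != 0 by rewrite gt_eqF.
have -> : (l - k)%:R * r - (Num.floor (y l) - Num.floor (y k))%:~R * T = (z l - z k) * T.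
  rewrite natrB; last exact: ltnW.
  by rewrite rmorphB /z /= /y; field.
rewrite normrM (gtr0_norm T_gt0).
have h1 : `|z l - z k| < N.+1%:R^-1 by rewrite -[X in _ < X]mul1r ltr_pdivlMr.
apply: (@lt_trans _ _ (N.+1%:R^-1 * T)); first by rewrite ltr_pM2r.
by rewrite mulrC ltr_pdivrMr// mulrC -ltr_pdivrMr.
Qed.

(** If (n + 1) r is within e of m T, then s - (n + 1) r + m T is a point of TS
    within e of s. It is obtained from s - r by going back n more times, so it
    exists as soon as s - r is in TS; and TS is closed. *)
Lemma ts_delay_iff r : [set t - r | t in TS] `<=` TS ->
  forall s, TS s <-> TS (s - r).
Proof.
move=> Tr; have back n s : TS s -> TS (s - n%:R * r).
  elim: n s => [|n IH] s Ts; first by rewrite mul0r subr0.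
  by rewrite -natr1 mulrDl mul1r opprD addrA; apply: Tr; exists (s - n%:R * r); first exact: IH.
move=> s; split=> [Ts|Ts]; first by apply: Tr; exists s.
apply: closed_approx => // e e0; have [n [m nm]] := simultaneous_return r e0.
exists (s - r - n%:R * r + m%:~R * T); first exact/ts_add_int/back.
rewrite -normrN; congr (_ < _) : nm; congr `|_|; rewrite -natr1; ring.
Qed.

(** The distance from x to the multiples of T. *)
Definition circ (x : R) : R :=
  let z := x - (Num.floor (x / T))%:~R * T in Num.min z (T - z).

Lemma circ_le x (k : int) : circ x <= `|x - k%:~R * T|.
Proof.
have /andP[] := mod_period x; rewrite /circ; set f := Num.floor _; set z := x - _ => z0 zT.
rewrite ge_min; have [kf|fk] := leP k f.
  apply/orP; left; rewrite (le_trans _ (ler_norm _))// /z lerD2l lerN2 ler_pM2r//.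
  by rewrite ler_int.
apply/orP; right; rewrite distrC (le_trans _ (ler_norm _))//.
have : (f + 1)%:~R * T <= k%:~R * T by rewrite ler_pM2r// ler_int lezD1.
by rewrite intrD mulrDl mul1r /z; lra.
Qed.

Lemma circ_attained x : exists k : int, circ x = `|x - k%:~R * T|.
Proof.
have /andP[] := mod_period x; rewrite /circ; set f := Num.floor _; set z := x - _ => z0 zT.
have [zz|zz] := leP z (T - z).
  by exists f; rewrite ger0_norm.
exists (f + 1); rewrite distrC ger0_norm; rewrite intrD mulrDl mul1r /z in z0 zT zz *; lra.
Qed.

Lemma circ0 : circ 0 = 0.
Proof.
have := circ_le 0 0; have [k ->] := circ_attained 0.
by rewrite mul0r subrr normr0 => h; apply/eqP; rewrite eq_le h normr_ge0.
Qed.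

Lemma circ_le_norm x : circ x <= `|x|.
Proof. by have := circ_le x 0; rewrite mul0r subr0. Qed.

Lemma circ_period : circ T = 0.
Proof.
have := circ_le T 1; have [k ->] := circ_attained T.
by rewrite mul1r subrr normr0 => h; apply/eqP; rewrite eq_le h normr_ge0.
Qed.

Lemma circ_le_period x : circ x <= T.
Proof.
apply: le_trans (circ_le x (Num.floor (x / T))) _.
by have /andP[h1 /ltW] := mod_period x; rewrite ger0_norm.
Qed.

Lemma circC x y : circ (x - y) = circ (y - x).
Proof.
suff h a b : circ (a - b) <= circ (b - a) by apply/eqP; rewrite eq_le !h.
have [k ->] := circ_attained (b - a); apply: le_trans (circ_le _ (- k)) _.
have -> : a - b - (- k)%:~R * T = - (b - a - k%:~R * T) by rewrite rmorphN /=; ring.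
by rewrite normrN.
Qed.

Lemma circ_triangle x y z : circ (x - z) <= circ (x - y) + circ (y - z).
Proof.
have [k ->] := circ_attained (x - y); have [l ->] := circ_attained (y - z).
apply: le_trans (circ_le _ (k + l)) _; apply: le_trans (ler_normD _ _).
rewrite le_eqVlt; apply/orP; left; apply/eqP; congr `|_|.
by rewrite intrD; ring.
Qed.

Lemma periodic_int f (k : int) t : periodic_on TS T f -> TS t ->
  f (t + k%:~R * T) = f t.
Proof.
move=> fp; have nat_case (m : nat) u : TS u -> f (u + m%:R * T) = f u.
  elim: m u => [|m IH] u Tu; first by rewrite mul0r addr0.
  rewrite -natr1 mulrDl mul1r addrA fp ?IH//.
  exact: (ts_add_int (Posz m)).
move=> Tt; case: k => m; first exact: nat_case.
have Tu := ts_add_int (Negz m) Tt.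
by rewrite -(nat_case m.+1 _ Tu) NegzE mulrNz mulNr subrK.
Qed.

Lemma periodic_lipschitz f L : periodic_on TS T f ->
  (forall s t, TS s -> TS t -> `|f s - f t| <= L * `|s - t|) ->
  forall s t, TS s -> TS t -> `|f s - f t| <= L * circ (s - t).
Proof.
move=> fp fL s t Ts Tt; have [k ->] := circ_attained (s - t).
rewrite -(periodic_int k fp Tt) (le_trans (fL _ _ Ts _)) ?opprD ?addrA//.
exact: ts_add_int.
Qed.

Definition continuous_periodic f := {within TS, continuous f} /\ periodic_on TS T f.

Lemma continuous_periodic_bounded f : continuous_periodic f ->
  exists2 B, 0 < B & forall t, TS t -> `|f t| <= B.
Proof.
move=> [fc fp]; have cA : compact (`[0, T] `&` TS).
  by apply: compact_closedI => //; exact: segment_compact.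
have [B B0 fB] := continuous_bounded_on cA
  (continuous_subspaceW (@subIsetr _ _ _) fc).
exists B => // t Tt; pose k := - Num.floor (t / T).
rewrite -(periodic_int k fp Tt); apply: fB; split; last exact: ts_add_int.
by rewrite /= in_itv /= /k rmorphN /= mulNr; have /andP[-> /ltW ->] := mod_period t.
Qed.

Lemma lipschitz_within f L :
  (forall s t, TS s -> TS t -> `|f s - f t| <= L * `|s - t|) ->
  {within TS, continuous f}.
Proof.
move=> fL; apply/within_continuousP => t Tt e e0.
have L0 : 0 < `|L| + 1 by have := normr_ge0 L; lra.
exists (e / (`|L| + 1)); first exact: divr_gt0.
move=> s Ts; rewrite ltr_pdivlMr// => st; apply: le_lt_trans (fL _ _ Ts Tt) _.
apply: le_lt_trans st; rewrite mulrC ler_wpM2l//.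
by have := ler_norm L; lra.
Qed.

Definition delta_primitive f t := delta_integral TS f 0 t.
Local Notation A := delta_primitive.

Lemma delta_primitiveP f : {within TS, continuous f} -> delta_antiderivative TS (A f) f.
Proof.
move=> fc; have [F Ff] := delta_antiderivative_exists TS_closed ts_above ts_below fc.
move=> t Tt; apply: (@eq_delta_derivative _ _ TS_closed ts_above (fun s => F s - F 0)) => //.
  by move=> s Ts; rewrite /A (delta_integralE TS_closed ts_above Ff).
rewrite -[f t]subr0; apply: is_delta_derivativeB; first exact: Ff.
exact: is_delta_derivative_cst.
Qed.

Lemma delta_primitive_unique F f t : delta_antiderivative TS F f -> TS t ->
  A f t = F t - F 0.
Proof. by move=> Ff Tt; exact: (delta_integralE TS_closed ts_above Ff TS0 Tt). Qed.

Lemma delta_primitive0 f : {within TS, continuous f} -> A f 0 = 0.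
Proof.
by move=> fc; rewrite (delta_primitive_unique (delta_primitiveP fc))// subrr.
Qed.

Lemma delta_primitive_period f t : continuous_periodic f -> TS t ->
  A f (t + T) = A f t + A f T.
Proof.
move=> [fc fp] Tt.
have /delta_primitive_unique/(_ Tt) : delta_antiderivative TS (fun s => A f (s + T)) f.
  move=> s Ts; apply: is_delta_derivative_shift => //; first exact: ts_above.
    exact: ts_shift.
  by rewrite -fp//; apply: delta_primitiveP => //; exact: (ts_shift _).1.
by rewrite add0r => ->; rewrite subrK.
Qed.

Lemma delta_primitiveB f g t : {within TS, continuous f} -> {within TS, continuous g} ->
  TS t -> A (fun s => f s - g s) t = A f t - A g t.
Proof.
move=> fc gc Tt.
rewrite (@delta_primitive_unique (fun s => A f s - A g s))//.
  by rewrite !delta_primitive0// subrr subr0.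
by move=> s Ts; apply: is_delta_derivativeB; exact: delta_primitiveP.
Qed.

Lemma delta_primitiveD f g t : {within TS, continuous f} -> {within TS, continuous g} ->
  TS t -> A (fun s => f s + g s) t = A f t + A g t.
Proof.
move=> fc gc Tt.
rewrite (@delta_primitive_unique (fun s => A f s + A g s))//.
  by rewrite !delta_primitive0// addr0 subr0.
by move=> s Ts; apply: is_delta_derivativeD; exact: delta_primitiveP.
Qed.

Lemma delta_primitive_le0 f : {within TS, continuous f} ->
  (forall t, TS t -> f t <= 0) -> A f T <= 0.
Proof.
move=> fc f0; have := delta_mean_value TS_closed ts_above (delta_primitiveP fc) f0
  TS0 ts_period (ltW T_gt0).
by rewrite mul0r delta_primitive0// subr0.
Qed.

Lemma delta_primitive_ge0 f : {within TS, continuous f} ->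
  (forall t, TS t -> 0 <= f t) -> 0 <= A f T.
Proof.
move=> fc f0; have f'c : {within TS, continuous (fun t => 0 - f t)}.
  by move=> t; apply: continuousB; [exact: cvg_cst|exact: fc].
have zc : {within TS, continuous (fun=> 0 : R)}.
  by apply: continuous_subspaceT => t; exact: cvg_cst.
have := delta_primitive_le0 f'c (fun t Tt => (ltac:(by have := f0 t Tt; lra))).
rewrite delta_primitiveB//; last exact: ts_period.
have := delta_primitive_le0 zc (fun t _ => lexx 0).
suff : A (fun=> 0) T = 0 by move=> ->; lra.
have zz t : TS t -> is_delta_derivative TS (fun=> 0 : R) t 0.
  by move=> _; exact: is_delta_derivative_cst.
by rewrite (delta_primitive_unique zz ts_period) subrr.
Qed.

Lemma delta_primitive_close f g e t : {within TS, continuous f} -> {within TS, continuous g} ->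
  (forall t, TS t -> `|f t - g t| <= e) -> TS t -> `|A f t - A g t| <= e * `|t|.
Proof.
move=> fc gc fg Tt.
have FG : delta_antiderivative TS (fun s => A f s - A g s) (fun s => f s - g s).
  by move=> s Ts; apply: is_delta_derivativeB; exact: delta_primitiveP.
have := delta_mean_value_norm TS_closed ts_above FG fg TS0 Tt.
by rewrite !delta_primitive0// !subr0.
Qed.

(** A shifted antiderivative is an antiderivative of the shifted function, and its
    increment over a period does not depend on where the period starts. *)
Lemma delta_primitive_delay f r : (forall s, TS s <-> TS (s - r)) ->
  continuous_periodic f -> A (fun t => f (t - r)) T = A f T.
Proof.
move=> Tr fcp; have [fc fp] := fcp; have TT := ts_period.
have Tr0 : TS (- r) by rewrite -sub0r; exact: (Tr 0).1.
rewrite (@delta_primitive_unique (fun t => A f (t - r)))//.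
  by rewrite sub0r [T - r]addrC delta_primitive_period// addrAC subrr add0r.
move=> t Tt; apply: (is_delta_derivative_shift ts_above Tr).
by apply: delta_primitiveP => //; exact: (Tr t).1.
Qed.

(** Subtracting the mean of f is what makes its primitive periodic. *)
Definition periodic_primitive f t := A f t - A f T / T * t.
Local Notation P := periodic_primitive.

Lemma periodic_primitive0 f : {within TS, continuous f} -> P f 0 = 0.
Proof. by move=> fc; rewrite /P delta_primitive0// mulr0 subr0. Qed.

Lemma periodic_primitiveP f : {within TS, continuous f} ->
  delta_antiderivative TS (P f) (fun t => f t - A f T / T).
Proof.
move=> fc t Tt; apply: is_delta_derivativeB; first exact: delta_primitiveP.
rewrite -[X in is_delta_derivative _ _ _ X]mulr1; apply: is_delta_derivativeZ.
exact: is_delta_derivative_id.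
Qed.

Lemma periodic_primitive_periodic f : continuous_periodic f -> periodic_on TS T (P f).
Proof.
move=> fcp t Tt; rewrite /P delta_primitive_period// mulrDr divfK ?gt_eqF//; ring.
Qed.

(** One e bounds f - g and another one the difference of the means. *)
Lemma periodic_primitive_close f g e : continuous_periodic f -> continuous_periodic g ->
  (forall t, TS t -> `|f t - g t| <= e) -> forall s t, TS s -> TS t ->
  `|(P f s - P g s) - (P f t - P g t)| <= e *+ 2 * circ (s - t).
Proof.
move=> fcp gcp fg; have [fc fp] := fcp; have [gc gp] := gcp.
apply: (periodic_lipschitz (f := fun s => P f s - P g s)).
  by move=> t Tt; rewrite !periodic_primitive_periodic.
have TT := ts_period.
have FG : delta_antiderivative TS (fun s => P f s - P g s)
    (fun s => (f s - A f T / T) - (g s - A g T / T)).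
  by move=> s Ts; apply: is_delta_derivativeB; exact: periodic_primitiveP.
move=> s t Ts Tt; apply: (delta_mean_value_norm TS_closed ts_above FG) => // u Tu.
have := delta_primitive_close fc gc fg TT; rewrite (gtr0_norm T_gt0) => h.
have -> : f u - A f T / T - (g u - A g T / T) = (f u - g u) - (A f T - A g T) / T.
  by rewrite mulrBl; ring.
rewrite (le_trans (ler_normB _ _))// mulr2n lerD ?fg//.
by rewrite normrM normfV (gtr0_norm T_gt0) ler_pdivrMr.
Qed.

Lemma continuous_periodic_cst c : continuous_periodic (fun=> c).
Proof. by split=> //; apply: continuous_subspaceT; exact: cst_continuous. Qed.

Lemma periodic_primitive_cst c t : TS t -> P (fun=> c) t = 0.
Proof.
move=> Tt; have h s : TS s -> A (fun=> c) s = c * s.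
  move=> Ts; rewrite (@delta_primitive_unique (fun t => c * t))//.
    by rewrite mulr0 subr0.
  move=> u Tu; rewrite -[X in is_delta_derivative _ _ _ X]mulr1.
  by apply: is_delta_derivativeZ; exact: is_delta_derivative_id.
rewrite /P !h//; last exact: ts_period.
by rewrite mulfK ?subrr// gt_eqF.
Qed.

Lemma periodic_primitive_lipschitz f B : continuous_periodic f ->
  (forall t, TS t -> `|f t| <= B) -> forall s t, TS s -> TS t ->
  `|P f s - P f t| <= B *+ 2 * circ (s - t).
Proof.
move=> fcp fB s t Ts Tt.
have := @periodic_primitive_close f _ B fcp (continuous_periodic_cst 0) _ s t Ts Tt.
by rewrite !periodic_primitive_cst// !subr0; apply => u Tu; rewrite subr0 fB.
Qed.

Lemma continuous_periodic_primitive f : continuous_periodic f -> continuous_periodic (P f).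
Proof.
move=> fcp; split; last exact: periodic_primitive_periodic.
have [B B0 fB] := continuous_periodic_bounded fcp.
apply: (@lipschitz_within _ (B *+ 2)) => s t Ts Tt.
apply: le_trans (periodic_primitive_lipschitz fcp fB Ts Tt) _.
by rewrite ler_wpM2l ?circ_le_norm// mulrn_wge0// ltW.
Qed.

Lemma continuous_periodicD f g : continuous_periodic f -> continuous_periodic g ->
  continuous_periodic (fun t => f t + g t).
Proof.
move=> [fc fp] [gc gp]; split; last by move=> t Tt; rewrite fp// gp.
by move=> t; apply: continuousD; [exact: fc|exact: gc].
Qed.

Lemma continuous_periodicM f g : continuous_periodic f -> continuous_periodic g ->
  continuous_periodic (fun t => f t * g t).
Proof.
move=> [fc fp] [gc gp]; split; last by move=> t Tt; rewrite fp// gp.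
by move=> t; apply: continuousM; [exact: fc|exact: gc].
Qed.

Lemma continuous_periodic_comp (k : R -> R) f : continuous k -> continuous_periodic f ->
  continuous_periodic (fun t => k (f t)).
Proof.
move=> kc [fc fp]; split; last by move=> t Tt; rewrite fp.
by move=> t; exact: (continuous_comp (fc t) (kc (f t))).
Qed.

Lemma continuous_periodic_delay r f : (forall s, TS s -> TS (s - r)) ->
  continuous_periodic f -> continuous_periodic (fun t => f (t - r)).
Proof.
move=> Tr [fc fp]; split; last by move=> t Tt; rewrite addrAC fp//; exact: Tr.
apply/within_continuousP => t Tt e e0.
have [del del0 h] := (within_continuousP TS f).1 fc _ (Tr _ Tt) e e0.
exists del => // s Ts st; apply: h; first exact: Tr.
by rewrite opprB addrA subrK.
Qed.

Lemma circ_totally_bounded e : 0 < e -> exists2 s : seq R,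
  (forall t, t \in s -> TS t) & forall t, TS t -> exists2 u, u \in s & circ (t - u) <= e.
Proof.
move=> e0; pose m := (Num.trunc (T / e)).+1.
have mT : T / e < m%:R := truncnS_gt _.
have m0 : 0 < m%:R :> R by rewrite ltr0n.
pose cell (k : nat) := [set t | TS t /\ k%:R <= t / T * m%:R < k.+1%:R].
pose pick k := xget 0 (cell k).
exists [seq pick k | k <- iota 0 m].
  by move=> t /mapP[k _ ->]; rewrite /pick; case: xgetP => [u _ []|].
move=> t Tt; pose t0 := t - (Num.floor (t / T))%:~R * T.
have Tt0 : TS t0.
  by have := (ts_shift_int (- Num.floor (t / T)) t).1 Tt; rewrite rmorphN /= mulNr.
have /andP[t00 t0T] := mod_period t; rewrite -/t0 in t00 t0T.
have t0m : 0 <= t0 / T * m%:R by rewrite !mulr_ge0// ltW// invr_gt0.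
pose k := Num.trunc (t0 / T * m%:R).
have kt0 : cell k t0 by split => //; exact: truncn_itv.
exists (pick k).
  apply/mapP; exists k => //; rewrite mem_iota /= add0n truncn_lt_nat//.
  by rewrite -[ltRHS]mul1r ltr_pM2r// ltr_pdivrMr// mul1r.
have [_ /andP[k1 k2]] : cell k (pick k) := xgetI 0 kt0.
have [_ /andP[k3 k4]] := kt0.
apply: le_trans (circ_le _ (Num.floor (t / T))) _.
have -> : t - pick k - (Num.floor (t / T))%:~R * T = t0 - pick k by rewrite /t0; ring.
have T0 : T != 0 by rewrite gt_eqF.
rewrite (_ : t0 - pick k = (t0 / T * m%:R - pick k / T * m%:R) * (T / m%:R)); last first.
  by field; rewrite T0 gt_eqF.
have Tm : T / m%:R < e by rewrite ltr_pdivrMr// mulrC -ltr_pdivrMr.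
have Tm0 : 0 < T / m%:R by rewrite divr_gt0.
rewrite normrM (gtr0_norm Tm0) (le_trans _ (ltW Tm))// -[leRHS]mul1r ler_pM2r//.
rewrite -natr1 in k2 k4.
by rewrite ler_norml; apply/andP; split; lra.
Qed.

End PeriodicTimeScale.

(** * The shooting operator and its fixed points *)

Section Clip.
Variable R : realType.
Implicit Types lo hi x y c del : R.

Definition clip lo hi x := Num.max lo (Num.min hi x).

Lemma clip_cases lo hi x : lo <= hi ->
  [\/ x < lo /\ clip lo hi x = lo, hi < x /\ clip lo hi x = hi
    | lo <= x <= hi /\ clip lo hi x = x].
Proof.
move=> lohi; rewrite /clip; have [xlo|lox] := ltP x lo.
  by constructor 1; split => //; rewrite min_r ?max_l ?ltW// (lt_le_trans xlo).
have [hix|xhi] := ltP hi x.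
  by constructor 2; split => //; rewrite max_r.
by constructor 3; split => //; rewrite ?min_r// max_r.
Qed.

Lemma clip_in lo hi x : lo <= hi -> lo <= clip lo hi x <= hi.
Proof.
by move=> lohi; case: (clip_cases x lohi) => -[h ->] //; rewrite lohi lexx.
Qed.

Lemma clip_id lo hi x : lo <= x <= hi -> clip lo hi x = x.
Proof.
move=> /andP[lx xh]; case: (clip_cases x (le_trans lx xh)) => -[h ->] //; lra.
Qed.

Lemma clip_nonexpansive lo hi x y : lo <= hi ->
  `|clip lo hi x - clip lo hi y| <= `|x - y|.
Proof.
move=> lohi; have h u v : clip lo hi u - clip lo hi v <= `|u - v|.
  have := ler_norm (u - v); have := normr_ge0 (u - v).
  by case: (clip_cases u lohi) => -[+ ->]; case: (clip_cases v lohi) => -[+ ->]; lra.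
by rewrite ler_norml lerNl opprB h distrC h.
Qed.

(** A fixed point of a truncated translation is either a fixed point of the
    translation or an end of the interval towards which it pushes. *)
Lemma clip_fixed lo hi c del : lo <= hi -> clip lo hi (c + del) = c ->
  [\/ del = 0, c = lo /\ del < 0 | c = hi /\ 0 < del].
Proof.
move=> lohi; case: (clip_cases (c + del) lohi) => -[h ->] e.
- by constructor 2; split; [|lra].
- by constructor 3; split; [|lra].
- by constructor 1; lra.
Qed.

End Clip.

Lemma eq_within_continuous (R : realType) (TS : set R) (f g : R -> R) :
  (forall t, TS t -> f t = g t) -> {within TS, continuous f} -> {within TS, continuous g}.
Proof.
move=> fg fc; apply/within_continuousP => t Tt e e0.
have [del del0 h] := (within_continuousP TS f).1 fc t Tt e e0.
by exists del => // s Ts st; rewrite -!fg//; exact: h.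
Qed.

(** The operator acts on functions on option R: None carries the initial value c
    and Some t the momentum v(t). Here lo < hi are two consecutive levels, and
    kappa is the sign (-1)^j. *)
Section ShootingOperator.
Variables (R : realType) (TS : set R) (T r a : R) (phi psi h g p : R -> R).
Hypotheses (T_gt0 : 0 < T) (TS_closed : closed TS)
  (TS_per : periodic_time_scale TS T) (TS0 : TS 0)
  (TS_delay : forall s, TS s <-> TS (s - r)) (a_gt0 : 0 < a).
Hypotheses (psi_cont : continuous psi) (psi_lt : forall y, `|psi y| < a)
  (psiK : forall y, phi (psi y) = y) (psi_homo : {homo psi : x y / x <= y})
  (psi0 : psi 0 = 0) (h_cont : continuous h) (g_cont : continuous g)
  (p_cp : continuous_periodic TS T p) (p_mean : delta_primitive TS p T = 0).
Variables (lo hi kappa : R).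
Hypotheses (lo_lt_hi : lo < hi) (kappa1 : `|kappa| = 1).
Hypothesis lo_sign : forall x, C1T TS T x -> x 0 = lo ->
  (sup_norm TS (delta_derivative TS x) < a%:E)%E ->
  kappa * delta_integral TS
    (fun t => h (x t) * delta_derivative TS x t + g (x t)) 0 T < 0.
Hypothesis hi_sign : forall x, C1T TS T x -> x 0 = hi ->
  (sup_norm TS (delta_derivative TS x) < a%:E)%E ->
  0 < kappa * delta_integral TS
    (fun t => h (x t) * delta_derivative TS x t + g (x t)) 0 T.
Let X := `|lo| + `|hi| + a *+ 2 * T.
Variables Bp Bh Bg : R.
Hypotheses (Bp_gt0 : 0 < Bp) (pB : forall t, TS t -> `|p t| <= Bp).
Hypotheses (Bh_gt0 : 0 < Bh) (hB : forall x, `|x| <= X -> `|h x| <= Bh).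
Hypotheses (Bg_gt0 : 0 < Bg) (gB : forall x, `|x| <= X -> `|g x| <= Bg).
Let B := Bp + Bh * a + Bg.
Let S := B *+ 2 * T.
(** The first S bounds the mean-free part of the momentum and the second its value
    at 0. The bound X on trajectories does not involve M: the initial value is
    clipped and velocities are below a. *)
Let M := S + S + `|lo| + `|hi| + 1.
Local Notation A := (delta_primitive TS).
Local Notation P := (periodic_primitive TS T).
Local Notation cper := (continuous_periodic TS T).
Local Notation circ := (circ T).
Implicit Types (z : option R -> R) (t : R).

Let B_gt0 : 0 < B.
Proof. by rewrite /B !addr_gt0// mulr_gt0. Qed.

Let S_gt0 : 0 < S.
Proof. by rewrite /S mulr_gt0// mulrn_wgt0. Qed.

Let M_gt0 : 0 < M.
Proof. by rewrite /M; have := S_gt0; have := normr_ge0 lo; have := normr_ge0 hi; lra. Qed.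

Let lohi : lo <= hi := ltW lo_lt_hi.

(** The momentum is to be 2 B-Lipschitz on the circle. The distance 2 M between
    the two kinds of indices makes no constraint on functions bounded by M. *)
Definition momentum_dist (i j : option R) : R :=
  match i, j with
  | Some s, Some t => B *+ 2 * circ (s - t)
  | None, None => 0
  | _, _ => M *+ 2
  end.
Local Notation dist := momentum_dist.

Let D : set (option R) := [set i | if i is Some t then TS t else True].

Let circ_ge0 x : 0 <= circ x.
Proof. by have [k ->] := circ_attained T_gt0 x. Qed.

Let Bcirc_le x : B *+ 2 * circ x <= S.
Proof. by rewrite /S ler_pM2l ?mulrn_wgt0// circ_le_period. Qed.

Let dist_refl i : dist i i = 0.
Proof. by case: i => [t|] //=; rewrite subrr circ0// mulr0. Qed.

Let dist_sym i j : dist i j = dist j i.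
Proof. by case: i j => [s|] [t|] //=; rewrite circC. Qed.

Let SM : S <= M.
Proof. by rewrite /M; have := S_gt0; have := normr_ge0 lo; have := normr_ge0 hi; lra. Qed.

Let dist_triangle i j k : dist i k <= dist i j + dist j k.
Proof.
have Bc x : 0 <= B *+ 2 * circ x by rewrite mulr_ge0// mulrn_wge0// ltW.
have M2 : 0 <= M *+ 2 by rewrite mulrn_wge0// ltW.
case: i j k => [s|] [t|] [u|] /=.
- by rewrite -mulrDr ler_pM2l ?mulrn_wgt0// circ_triangle.
- by rewrite lerDr.
- apply: le_trans (Bcirc_le _) _; have := SM; have := M_gt0.
  by rewrite -mulrnDr -mulr_natl; lra.
- by rewrite addr0.
- by rewrite lerDl.
- by rewrite addr_ge0.
- by rewrite add0r.
- by rewrite addr0.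
Qed.

Let D_totally_bounded e : 0 < e -> exists2 s : seq (option R),
  (forall j, j \in s -> D j) & forall i, D i -> exists2 j, j \in s & dist i j <= e.
Proof.
move=> e0; have B2 : 0 < B *+ 2 by rewrite mulrn_wgt0.
have [s sT sP] := circ_totally_bounded T_gt0 TS_per TS0 (divr_gt0 e0 B2).
exists (None :: map Some s).
  by move=> j; rewrite inE => /predU1P[-> //|/mapP[t ts ->]]; exact: sT.
case=> [t Tt|_]; last by exists None; rewrite ?mem_head//= ltW.
have [u us tu] := sP t Tt; exists (Some u); first by rewrite inE map_f.
by rewrite /= mulrC -ler_pdivlMr.
Qed.

Let ball := lipschitz_ball D dist M.

Definition velocity z t := psi (z (Some t)).
(** The initial value is clipped also off the fixed points, so that trajectories
    are bounded independently of M. *)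
Definition trajectory z t := clip lo hi (z None) + P (velocity z) t.
Definition forcing z t :=
  p t - h (trajectory z t) * velocity z t - g (trajectory z (t - r)).
(** The truncated terms are those which vanish for a solution: at a fixed point the
    velocity and the forcing are forced to have mean zero, and this replaces the
    choice of integration constants. *)
Definition shooting z (i : option R) :=
  match i with
  | None => clip lo hi (z None + kappa * A (forcing z) T)
  | Some t => P (forcing z) t + clip (- S) S (z (Some 0) - A (velocity z) T)
  end.

Let momentum_cp z : ball z -> cper (fun t => z (Some t)).
Proof.
move=> [_ zL]; split.
  apply: (@lipschitz_within _ _ _ (B *+ 2)) => s t Ts Tt.
  apply: le_trans (zL (Some s) (Some t) Ts Tt) _.
  by rewrite /= ler_pM2l ?mulrn_wgt0// circ_le_norm.
move=> t Tt; apply/eqP; rewrite -subr_eq0 -normr_le0.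
have := zL (Some (t + T)) (Some t) ((ts_shift TS_per t).1 Tt) Tt.
by rewrite /= addrAC subrr add0r circ_period// mulr0.
Qed.

Let velocity_cp z : ball z -> cper (velocity z).
Proof. by move=> zb; apply: continuous_periodic_comp => //; exact: momentum_cp. Qed.

Let primitive_bound f b t : cper f -> (forall t, TS t -> `|f t| <= b) -> TS t ->
  `|P f t| <= b *+ 2 * T.
Proof.
move=> fcp fb Tt.
have := periodic_primitive_lipschitz T_gt0 TS_closed TS_per TS0 fcp fb Tt TS0.
rewrite periodic_primitive0//; last exact: fcp.1.
rewrite !subr0 => /le_trans; apply; rewrite ler_wpM2l ?circ_le_period//.
by rewrite mulrn_wge0// (le_trans _ (fb 0 TS0)).
Qed.

Let trajectory_cp z : ball z -> cper (trajectory z).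
Proof.
move=> zb; apply: continuous_periodicD; first exact: continuous_periodic_cst.
by apply: continuous_periodic_primitive => //; exact: velocity_cp.
Qed.

Let velocity_le z t : `|velocity z t| <= a.
Proof. exact: ltW (psi_lt _). Qed.

Let clip_le x : `|clip lo hi x| <= `|lo| + `|hi|.
Proof.
have /andP[] := clip_in x lohi; have := ler_norm hi; have := ler_norm (- lo).
rewrite normrN; have := normr_ge0 lo; have := normr_ge0 hi => *.
by rewrite ler_norml; apply/andP; split; lra.
Qed.

Let trajectory_le z t : ball z -> TS t -> `|trajectory z t| <= X.
Proof.
move=> zb Tt; rewrite (le_trans (ler_normD _ _))// lerD//.
by apply: primitive_bound Tt => [|u _]; [exact: velocity_cp|exact: velocity_le].
Qed.

Let delayed_cp z : ball z -> cper (fun t => trajectory z (t - r)).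
Proof.
move=> zb; apply: continuous_periodic_delay; last exact: trajectory_cp.
by move=> s /TS_delay.
Qed.

Let friction_cp z : ball z -> cper (fun t => h (trajectory z t) * velocity z t).
Proof.
move=> zb; apply: continuous_periodicM; last exact: velocity_cp.
by apply: continuous_periodic_comp => //; exact: trajectory_cp.
Qed.

Let cperB f k : cper f -> cper k -> cper (fun t => f t - k t).
Proof.
move=> fc kc; apply: continuous_periodicD => //.
by apply: (continuous_periodic_comp (k := -%R)) => // x; exact: oppr_continuous.
Qed.

Let forcing_cp z : ball z -> cper (forcing z).
Proof.
move=> zb; apply: cperB; first by apply: cperB => //; exact: friction_cp.
by apply: continuous_periodic_comp => //; exact: delayed_cp.
Qed.

Let forcing_le z t : ball z -> TS t -> `|forcing z t| <= B.
Proof.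
move=> zb Tt; rewrite (le_trans (ler_normB _ _))// lerD//; last first.
  by apply/gB/trajectory_le => //; exact: (TS_delay t).1.
rewrite (le_trans (ler_normB _ _))// lerD ?pB// normrM.
by apply: ler_pM; rewrite ?normr_ge0 ?velocity_le//; apply: hB; exact: trajectory_le.
Qed.

Let forcing_primitive_le z t : ball z -> TS t -> `|P (forcing z) t| <= S.
Proof.
by move=> zb Tt; apply: primitive_bound => //; [exact: forcing_cp|move=> u; exact: forcing_le].
Qed.

Let clipS_le x : `|clip (- S) S x| <= S.
Proof. by have := @clip_in _ (- S) S x (ltac:(have := S_gt0; lra)); rewrite ler_norml. Qed.

Let shooting_ball z : ball z -> ball (shooting z).
Proof.
move=> zb; have h1 i : D i -> `|shooting z i| <= M.
  case: i => [t|] Di /=.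
    have := ler_normD (P (forcing z) t) (clip (- S) S (z (Some 0) - A (velocity z) T)).
    have := forcing_primitive_le zb Di; have := clipS_le (z (Some 0) - A (velocity z) T).
    by rewrite /M; have := normr_ge0 lo; have := normr_ge0 hi; lra.
  rewrite (le_trans (clip_le _))// /M; have := S_gt0; lra.
split=> // i j Di Dj; case: i j Di Dj => [s|] [t|] Di Dj.
- rewrite /= [P _ s + _]addrC [P _ t + _]addrC opprD addrACA subrr add0r.
  apply: periodic_primitive_lipschitz => //; first exact: forcing_cp.
  by move=> u; exact: forcing_le.
- by rewrite (le_trans (ler_normB _ _))//= mulr2n lerD//; [exact: (h1 (Some s))|exact: (h1 None)].
- by rewrite (le_trans (ler_normB _ _))//= mulr2n lerD//; [exact: (h1 None)|exact: (h1 (Some t))].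
- by rewrite subrr normr0.
Qed.

(** Uniform continuity for the sup-norms over D and over TS, of an operator whose
    values are functions of time. *)
Definition ucont (G : (option R -> R) -> R -> R) := forall e, 0 < e ->
  exists2 del, 0 < del & forall z z', ball z -> ball z' ->
    (forall i, D i -> `|z i - z' i| <= del) ->
    forall t, TS t -> `|G z t - G z' t| <= e.

Let ucont_coord i : D i -> ucont (fun z _ => z i).
Proof. by move=> Di e e0; exists e => // z z' _ _ zz t _; exact: zz. Qed.

Let ucont_momentum : ucont (fun z t => z (Some t)).
Proof. by move=> e e0; exists e => // z z' _ _ zz t Tt; exact: zz. Qed.

Let ucont_cst f : ucont (fun _ t => f t).
Proof.
by move=> e e0; exists 1 => // z z' _ _ zz t Tt; rewrite subrr normr0 ltW.
Qed.

Let ucontD G H : ucont G -> ucont H -> ucont (fun z t => G z t + H z t).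
Proof.
move=> Gc Hc e e0; have e20 : 0 < e / 2 by lra.
have [d1 d10 h1] := Gc _ e20; have [d2 d20 h2] := Hc _ e20.
exists (Num.min d1 d2); first by rewrite lt_min d10.
move=> z z' zb zb' zz t Tt; rewrite opprD addrACA (le_trans (ler_normD _ _))//.
have zz1 i : D i -> `|z i - z' i| <= d1 by move=> /zz; rewrite le_min => /andP[].
have zz2 i : D i -> `|z i - z' i| <= d2 by move=> /zz; rewrite le_min => /andP[].
have := h1 z z' zb zb' zz1 t Tt; have := h2 z z' zb zb' zz2 t Tt.
lra.
Qed.

Let ucont_comp k b G : continuous k -> ucont G ->
  (forall z t, ball z -> TS t -> `|G z t| <= b) -> ucont (fun z t => k (G z t)).
Proof.
move=> kc Gc Gb e e0; have [d1 d10 h1] := heine b kc e0.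
have [d2 d20 h2] := Gc _ d10; exists d2 => // z z' zb zb' zz t Tt.
by apply: h1; [exact: Gb|exact: h2].
Qed.

Let ucontM G H b c : ucont G -> ucont H ->
  (forall z t, ball z -> TS t -> `|G z t| <= b) ->
  (forall z t, ball z -> TS t -> `|H z t| <= c) ->
  ucont (fun z t => G z t * H z t).
Proof.
move=> Gc Hc Gb Hb e e0.
have b0 : 0 < `|b| + 1 by have := normr_ge0 b; lra.
have c0 : 0 < `|c| + 1 by have := normr_ge0 c; lra.
have [d1 d10 h1] := Gc (e / 2 / (`|c| + 1)) (ltac:(by rewrite !divr_gt0)).
have [d2 d20 h2] := Hc (e / 2 / (`|b| + 1)) (ltac:(by rewrite !divr_gt0)).
exists (Num.min d1 d2); first by rewrite lt_min d10.
move=> z z' zb zb' zz t Tt.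
have zz1 i : D i -> `|z i - z' i| <= d1 by move=> /zz; rewrite le_min => /andP[].
have zz2 i : D i -> `|z i - z' i| <= d2 by move=> /zz; rewrite le_min => /andP[].
have g1 := h1 z z' zb zb' zz1 t Tt; have g2 := h2 z z' zb zb' zz2 t Tt.
have -> : G z t * H z t - G z' t * H z' t =
  (G z t - G z' t) * H z t + G z' t * (H z t - H z' t) by ring.
rewrite (le_trans (ler_normD _ _))// !normrM.
have Gb' : `|G z' t| <= `|b| + 1 by rewrite (le_trans (Gb _ _ zb' Tt))//; have := ler_norm b; lra.
have Hb' : `|H z t| <= `|c| + 1 by rewrite (le_trans (Hb _ _ zb Tt))//; have := ler_norm c; lra.
have -> : e = e / 2 / (`|c| + 1) * (`|c| + 1) + (`|b| + 1) * (e / 2 / (`|b| + 1)).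
  by field; rewrite !gt_eqF.
by rewrite lerD// ler_pM.
Qed.

Let ucont_clip l u G : l <= u -> ucont G -> ucont (fun z t => clip l u (G z t)).
Proof.
move=> lu Gc e e0; have [d1 d10 h1] := Gc _ e0; exists d1 => // z z' zb zb' zz t Tt.
by apply: le_trans (clip_nonexpansive _ _ lu) _; exact: h1.
Qed.

Let ucont_integral G : (forall z, ball z -> cper (G z)) -> ucont G ->
  ucont (fun z _ => A (G z) T).
Proof.
move=> Gp Gc e e0; have [d1 d10 h1] := Gc _ (divr_gt0 e0 T_gt0).
exists d1 => // z z' zb zb' zz t Tt.
have := delta_primitive_close T_gt0 TS_closed TS_per TS0 (Gp z zb).1 (Gp z' zb').1
  (h1 z z' zb zb' zz) (ts_period TS_per TS0).
by rewrite (gtr0_norm T_gt0) divfK// gt_eqF.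
Qed.

Let ucont_primitive G : (forall z, ball z -> cper (G z)) -> ucont G ->
  ucont (fun z t => P (G z) t).
Proof.
move=> Gp Gc e e0.
have [d1 d10 h1] := Gc (e / (2 * T)) (ltac:(by rewrite divr_gt0// mulr_gt0)).
exists d1 => // z z' zb zb' zz t Tt.
have := periodic_primitive_close T_gt0 TS_closed TS_per TS0 (Gp z zb) (Gp z' zb')
  (h1 z z' zb zb' zz) Tt TS0.
rewrite !periodic_primitive0//; [|exact: (Gp z' zb').1|exact: (Gp z zb).1].
rewrite !subr0 => /le_trans; apply.
have -> : e / (2 * T) *+ 2 = e / T by rewrite mulr2n; field; rewrite gt_eqF.
rewrite -ler_pdivlMl ?divr_gt0// invfM invrK mulrAC mulVf ?mul1r ?circ_le_period//.
by rewrite gt_eqF.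
Qed.

Let ucont_velocity : ucont velocity.
Proof. by apply: (@ucont_comp psi M) => // z t [zM _] Tt; exact: zM. Qed.

Let ucont_trajectory : ucont trajectory.
Proof.
apply: ucontD; first by apply: ucont_clip => //; exact: ucont_coord.
exact: ucont_primitive.
Qed.

Let ucont_delayed : ucont (fun z t => trajectory z (t - r)).
Proof.
move=> e /ucont_trajectory[d1 d10 h1]; exists d1 => // z z' zb zb' zz t Tt.
by apply: h1 => //; exact: (TS_delay t).1.
Qed.

Let ucontN G : ucont G -> ucont (fun z t => - G z t).
Proof.
move=> Gc e /Gc[d1 d10 h1]; exists d1 => // z z' zb zb' zz t Tt.
by rewrite -opprD normrN; exact: h1.
Qed.

Let ucontZ k G : `|k| <= 1 -> ucont G -> ucont (fun z t => k * G z t).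
Proof.
move=> k1 Gc e e0; have [d1 d10 h1] := Gc e e0; exists d1 => // z z' zb zb' zz t Tt.
rewrite -mulrBr normrM -[e]mul1r ler_pM//; exact: h1.
Qed.

Let ucont_forcing : ucont forcing.
Proof.
apply: ucontD; first apply: ucontD; first exact: ucont_cst.
  apply: ucontN; apply: (@ucontM _ _ Bh a) => //.
  - by apply: (@ucont_comp h X) => // z t; exact: trajectory_le.
  - by move=> z t zb Tt; apply/hB/trajectory_le.
apply: ucontN; apply: (@ucont_comp g X) => // z t zb Tt.
by apply: trajectory_le => //; exact: (TS_delay t).1.
Qed.

Let shooting_cont e : 0 < e -> exists2 del, 0 < del &
  forall z z', ball z -> ball z' -> (forall i, D i -> `|z i - z' i| <= del) ->
  forall i, D i -> `|shooting z i - shooting z' i| <= e.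
Proof.
move=> e0.
have c1 : ucont (fun z _ => shooting z None).
  apply: ucont_clip => //; apply: ucontD; first exact: ucont_coord.
  by apply: ucontZ; [rewrite kappa1|exact: ucont_integral].
have c2 : ucont (fun z t => shooting z (Some t)).
  apply: ucontD; first exact: ucont_primitive.
  apply: ucont_clip; first by have := S_gt0; lra.
  apply: ucontD; first exact: ucont_coord.
  by apply: ucontN; exact: ucont_integral.
have [d1 d10 h1] := c1 e e0; have [d2 d20 h2] := c2 e e0.
exists (Num.min d1 d2); first by rewrite lt_min d10.
move=> z z' zb zb' zz [t|] Di.
  by apply: h2 => // i Dj; rewrite (le_trans (zz i Dj))// ge_min lexx orbT.
by apply: (h1 z z' zb zb' _ 0 TS0) => i Dj; rewrite (le_trans (zz i Dj))// ge_min lexx.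
Qed.

(** The momentum stays in [-M, M], and psi is monotone; so the velocity stays away
    from the ends of the interval from - a to a. *)
Let sup_norm_lt (y : R -> R) z : ball z -> (forall t, TS t -> y t = velocity z t) ->
  (sup_norm TS y < a%:E)%E.
Proof.
move=> [zM _] yu; pose b := Num.max (psi M) (- psi (- M)).
have ba : b < a.
  rewrite /b gt_max; have := psi_lt M; have := psi_lt (- M).
  by rewrite !ltr_norml => /andP[h1 h2] /andP[h3 h4]; apply/andP; split; lra.
apply: (@le_lt_trans _ _ b%:E); last by rewrite lte_fin.
apply: ub_ereal_sup => _ [t Tt <-]; rewrite lee_fin yu//.
have := zM (Some t) Tt; rewrite ler_norml => /andP[/psi_homo h1 /psi_homo h2].
rewrite ler_norml /velocity; apply/andP; split.
  by rewrite lerNl le_max; apply/orP; right; rewrite lerN2.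
by rewrite le_max h2.
Qed.

(** A fixed point of the shooting operator gives the solution: neither truncation
    is active at it. *)
Theorem shooting_solution : exists x,
  periodic_solution TS T r a phi h g p x /\ lo < x 0 < hi.
Proof.
have [z zb zfix] := schauder_lipschitz M_gt0 dist_refl dist_sym dist_triangle
  D_totally_bounded shooting_ball shooting_cont.
pose u := velocity z; pose x := trajectory z; pose N := forcing z.
have TT := ts_period TS_per TS0.
have ucp : cper u := velocity_cp zb.
have xcp : cper x := trajectory_cp zb.
have Ncp : cper N := forcing_cp zb.
pose c := z None.
have cfix : clip lo hi (c + kappa * A N T) = c := zfix None I.
have cin : lo <= c <= hi by rewrite -cfix clip_in.
have vfix t : TS t -> P N t + clip (- S) S (z (Some 0) - A u T) = z (Some t).
  by move=> Tt; exact: (zfix (Some t) Tt).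
have v0 : clip (- S) S (z (Some 0) - A u T) = z (Some 0).
  by have := vfix 0 TS0; rewrite periodic_primitive0 ?add0r//; exact: Ncp.1.
have vE t : TS t -> z (Some t) = P N t + z (Some 0).
  by move=> Tt; rewrite -[RHS](congr1 _ v0) /= -vfix// v0.
have SS : - S <= S by have := S_gt0; lra.
(* If v(0) sits at an end of [-S, S], then v has the sign of that end, hence so
   have u and its integral, against the direction in which v(0) is pushed. *)
have Au : A u T = 0.
  case: (clip_fixed SS v0) => [|[v0E neg]|[v0E pos]]; first lra.
    suff : A u T <= 0 by lra.
    apply: (delta_primitive_le0 T_gt0 TS_closed TS_per TS0 ucp.1) => t Tt.
    rewrite -psi0; apply: psi_homo; rewrite vE//.
    by have := forcing_primitive_le zb Tt; rewrite ler_norml -/N => /andP[]; lra.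
  suff : 0 <= A u T by lra.
  apply: (delta_primitive_ge0 T_gt0 TS_closed TS_per TS0 ucp.1) => t Tt.
  rewrite -psi0; apply: psi_homo; rewrite vE//.
  by have := forcing_primitive_le zb Tt; rewrite ler_norml -/N => /andP[]; lra.
have x0 : x 0 = c.
  by rewrite /x /trajectory periodic_primitive0 ?addr0 ?clip_id//; exact: ucp.1.
have closedT := TS_closed; have above := ts_above T_gt0 TS_per TS0.
have xd t : TS t -> is_delta_derivative TS x t (u t).
  move=> Tt; rewrite -[u t]subr0 -(mul0r T^-1) -Au -[X in is_delta_derivative _ _ _ X]add0r.
  apply: is_delta_derivativeD; first exact: is_delta_derivative_cst.
  exact: periodic_primitiveP ucp.1 t Tt.
have xdE t : TS t -> delta_derivative TS x t = u t.
  by move=> Tt; exact: delta_derivativeE (xd t Tt).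
have xC1 : C1T TS T x.
  split; first exact: xcp.2.
  split; [exact: xcp.1|by move=> t Tt; exists (u t); exact: xd|].
  by apply: eq_within_continuous ucp.1 => t Tt; rewrite xdE.
have xa : (sup_norm TS (delta_derivative TS x) < a%:E)%E by exact: sup_norm_lt zb xdE.
have AN : A N T = - delta_integral TS
    (fun t => h (x t) * delta_derivative TS x t + g (x t)) 0 T.
  have hucp := friction_cp zb; have gxcp : cper (fun t => g (x t)).
    exact: continuous_periodic_comp.
  have gdcp : cper (fun t => g (x (t - r))).
    by apply: continuous_periodic_comp => //; exact: delayed_cp.
  have -> : delta_integral TS (fun t => h (x t) * delta_derivative TS x t + g (x t)) 0 T =
      A (fun t => h (x t) * u t + g (x t)) T.
    by apply: eq_delta_integral => t Tt; rewrite xdE.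
  rewrite (delta_primitiveD T_gt0 TS_closed TS_per TS0 hucp.1 gxcp.1)//.
  have /(_ T) := delta_primitiveB T_gt0 TS_closed TS_per TS0 (cperB p_cp hucp).1 gdcp.1.
  rewrite (delta_primitiveB T_gt0 TS_closed TS_per TS0 p_cp.1 hucp.1)//.
  rewrite p_mean (delta_primitive_delay T_gt0 TS_closed TS_per TS0 TS_delay gxcp).
  rewrite -/(A _ T) => /(_ TT); rewrite /N /forcing => ->; rewrite /x /u; ring.
(* At either end of [lo, hi] the sign hypothesis pushes c strictly inwards. *)
have clo : c = lo -> 0 < kappa * A N T.
  by move=> clo; have := lo_sign xC1 (etrans x0 clo) xa; rewrite AN mulrN; lra.
have chi : c = hi -> kappa * A N T < 0.
  by move=> chi; have := hi_sign xC1 (etrans x0 chi) xa; rewrite AN mulrN; lra.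
have kAN : kappa * A N T = 0.
  by case: (clip_fixed lohi cfix) => [//|[/clo]|[/chi]]; lra.
have AN0 : A N T = 0.
  move/eqP: kAN; rewrite mulf_eq0 => /orP[/eqP k0|/eqP//].
  by have := kappa1; rewrite k0 normr0 => /eqP; rewrite eq_sym oner_eq0.
have phiE t : TS t -> phi (delta_derivative TS x t) = z (Some t).
  by move=> Tt; rewrite xdE// psiK.
have vd t : TS t -> is_delta_derivative TS (fun t => phi (delta_derivative TS x t)) t (N t).
  move=> Tt; apply: (@eq_delta_derivative _ _ closedT above (fun t => P N t + z (Some 0))) => //.
    by move=> s Ts; rewrite phiE// vE.
  rewrite -[N t]subr0 -(mul0r T^-1) -AN0 -[X in is_delta_derivative _ _ _ X]addr0.
  apply: is_delta_derivativeD; last exact: is_delta_derivative_cst.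
  exact: periodic_primitiveP Ncp.1 t Tt.
have vdE t : TS t -> delta_derivative TS (fun t => phi (delta_derivative TS x t)) t = N t.
  by move=> Tt; exact: delta_derivativeE (vd t Tt).
exists x; split.
  split => //.
  - by move=> t Tt; rewrite xdE//; exact: psi_lt.
  - split; last 1 first.
    + by apply: eq_within_continuous Ncp.1 => t Tt; rewrite vdE.
    + by apply: eq_within_continuous (momentum_cp zb).1 => t Tt; rewrite phiE.
    + by move=> t Tt; exists (N t); exact: vd.
  - by move=> t Tt; rewrite vdE// xdE// /N /forcing -/x -/u; ring.
have /andP[c1 c2] := cin; rewrite x0 !lt_neqAle c1 c2 !andbT.
apply/andP; split; apply/eqP; [move/esym/clo|move/chi]; lra.
Qed.

End ShootingOperator.

(** * Solutions between consecutive levels *)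

Section IncreasingHomeomorphism.
Variables (R : realType) (a : R) (phi : R -> R).
Hypotheses (a_gt0 : 0 < a)
  (phi_homeo : increasing_homeomorphism `]- a, a[ setT phi) (phi0 : phi 0 = 0).

Lemma increasing_homeomorphism_inverse : exists psi : R -> R,
  [/\ continuous psi, forall y, `|psi y| < a, forall y, phi (psi y) = y,
      {homo psi : x y / x <= y} & psi 0 = 0].
Proof.
have [[psi [[_ psiA] phiK psiK _ psic]] phi_lt] := phi_homeo.
have psi_in y : `]- a, a[%classic (psi y) by exact: psiA.
have psiK' y : phi (psi y) = y by apply: psiK; rewrite in_setT.
exists psi; split => //.
- by apply/continuous_subspace_setT.
- by move=> y; have := psi_in y; rewrite /= in_itv /= ltr_norml.
- move=> x y xy; rewrite leNgt; apply/negP => /(phi_lt _ _ (psi_in y) (psi_in x)).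
  by rewrite !psiK'; rewrite ltNge xy.
- rewrite -[in LHS]phi0; apply: phiK.
  by rewrite inE /= in_itv /= a_gt0 andbT oppr_lt0.
Qed.

End IncreasingHomeomorphism.

Unset Implicit Arguments.
Set Strict Implicit.

Theorem theorem1p1 (R : realType) (T r : R) (TS : set R) (a : R)
    (phi h g : R -> R) (n : nat) (alpha : 'I_n.+1 -> R)
    (T_gt0 : 0 < T) (r_ge0 : 0 <= r)
    (TS_time_scale : time_scale TS)
    (TS_periodic : periodic_time_scale TS T)
    (TS_delay : [set t - r | t in TS] `<=` TS)
    (TS0 : TS 0)
    (a_gt0 : 0 < a)
    (phi_homeo : increasing_homeomorphism `]- a, a[ setT phi)
    (phi0 : phi 0 = 0)
    (h_cont : continuous h) (g_cont : continuous g)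
    (alpha_incr : forall i j : 'I_n.+1, (i < j)%N -> alpha i < alpha j)
    (alpha_sign : forall (j : 'I_n.+1) (x : R -> R),
        C1T TS T x -> x 0 = alpha j ->
        (sup_norm TS (delta_derivative TS x) < a%:E)%E ->
        (-1) ^+ j * delta_integral TS
          (fun t => h (x t) * delta_derivative TS x t + g (x t)) 0 T < 0) :
  forall p : R -> R,
    {within TS, continuous p} -> periodic_on TS T p ->
    T^-1 * delta_integral TS p 0 T = 0 ->
    exists xs : 'I_n -> R -> R,
      (forall i, periodic_solution TS T r a phi h g p (xs i)) /\
      (forall i j, i <> j -> exists2 t, TS t & xs i t <> xs j t).
Proof.
move=> p p_cont p_per p_mean.
have TS_closed := TS_time_scale.2.
have [psi [psi_cont psi_lt psiK psi_homo psi0]] :=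
  increasing_homeomorphism_inverse a_gt0 phi_homeo phi0.
have TS_delay' := ts_delay_iff T_gt0 TS_closed TS_periodic TS_delay.
have p_cp : continuous_periodic TS T p by [].
have Ap : delta_primitive TS p T = 0.
  move/eqP: p_mean; rewrite mulf_eq0 invr_eq0 gt_eqF//= => /eqP; exact.
have [Bp Bp_gt0 pB] := continuous_periodic_bounded T_gt0 TS_closed TS_periodic p_cp.
pose al (i : 'I_n) := alpha (widen_ord (leqnSn n) i).
pose ar (i : 'I_n) := alpha (lift ord0 i).
have band (i : 'I_n) : exists x, periodic_solution TS T r a phi h g p x /\
    al i < x 0 < ar i.
  have [Bh Bh_gt0 hB] := continuous_bounded_ball (`|al i| + `|ar i| + a *+ 2 * T) h_cont.
  have [Bg Bg_gt0 gB] := continuous_bounded_ball (`|al i| + `|ar i| + a *+ 2 * T) g_cont.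
  apply: (shooting_solution T_gt0 TS_closed TS_periodic TS0 TS_delay' a_gt0 psi_cont psi_lt
    psiK psi_homo psi0 h_cont g_cont p_cp Ap (kappa := (-1) ^+ i) _ _ _ _
    Bp_gt0 pB Bh_gt0 hB Bg_gt0 gB).
  - by apply: alpha_incr; rewrite lift0.
  - by rewrite normrX normrN1 expr1n.
  - by move=> x xC1 x0 xa; exact: (alpha_sign _ x xC1 x0 xa).
  - move=> x xC1 x0 xa; have := alpha_sign _ x xC1 x0 xa.
    by rewrite lift0 exprS mulN1r mulNr oppr_lt0.
have [xs xsP] := choice band.
exists xs; split=> [i|i j ij]; first by have [] := xsP i.
exists 0 => //; have [_ /andP[li ri]] := xsP i; have [_ /andP[lj rj]] := xsP j.
have sep (k l : 'I_n) : (k < l)%N -> ar k <= al l.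
  rewrite /ar /al => kl.
  have : (lift ord0 k <= widen_ord (leqnSn n) l)%N by rewrite lift0.
  by rewrite leq_eqVlt => /predU1P[/val_inj -> //|/alpha_incr/ltW].
case: (ltngtP i j) => [/sep|/sep|/val_inj //]; lra.
Qed.
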